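(* Let $n\ge 1$ be an integer. The maximum of the $4n$-th normalized Steklov eigenvalue $\tilde\sigma_{4n}(g)$ among all rotationally symmetric metrics $g=f(t)^2(dt^2+d\theta^2)$ on cylinders $[0,T]\times\mathbb{S}^1$ (all $T>0$) is achieved by the critical $n$-Möbius band immersed in $\mathbb{R}^4$, whose boundary meets the boundary of the ball orthogonally. The immersed critical $n$-Möbius band is parameterized by $$X(t,\theta)=(2n\sinh t\cos\theta,\ 2n\sinh t\sin\theta,\ \cosh(2nt)\cos(2n\theta),\ \cosh(2nt)\sin(2n\theta))$$ with $t\in[-T_{2n,1}(1)/2,\ T_{2n,1}(1)/2]$, $\theta\in\mathbb{S}^1$.
   Context: $\mathbb{S}^1=\mathbb{R}/2\pi\mathbb{Z}$; $f>0$ is smooth on $[0,T]$. For a compact Riemannian surface $(M,g)$ with nonempty boundary, the Dirichlet-to-Neumann map sends $u\in C^\infty(\partial M)$ to $\partial\hat u/\partial n$, with $\hat u$ the harmonic extension and $n$ the unit outward normal; its eigenvalues $0=\sigma_0(g)<\sigma_1(g)\le\sigma_2(g)\le\cdots$ (with multiplicity) are the Steklov eigenvalues, and $\tilde\sigma_k(g)=\sigma_k(g)L_g(\partial M)$, where $L_g(\partial M)$ is the length of $\partial M$. For an integer $k\ge2$, $T_{k,1}(1)$ is the unique positive root of $k\tanh(ks/2)=\coth(s/2)$. The ball is the Euclidean ball centered at the origin whose boundary sphere contains the boundary of the surface. ''Achieved by'' this surface means: the cylinder $[-T_{2n,1}(1)/2,T_{2n,1}(1)/2]\times\mathbb{S}^1$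 (identified with $[0,T_{2n,1}(1)]\times\mathbb{S}^1$ by translation in $t$), with the metric induced by $X$ from the Euclidean metric, attains the maximum. *)

(* Defs.v *)
From Stdlib Require Import Reals List ClassicalEpsilon.
From Coquelicot Require Import Coquelicot.
Open Scope R_scope.

Definition d_t (U : R -> R -> R) : R -> R -> R :=
  fun t th => Derive (fun s => U s th) t.
Definition d_th (U : R -> R -> R) : R -> R -> R :=
  fun t th => Derive (fun s => U t s) th.

Definition smooth1 (f : R -> R) : Prop := forall k x, ex_derive_n f k x.

Fixpoint Ck (k : nat) (U : R -> R -> R) : Prop :=
  match k with
  | O => forall t th, continuity_2d_pt U t th
  | S k' =>
      (forall t th, ex_derive (fun s => U s th) t /\ ex_derive (fun s => U t s) th)
      /\ Ck k' (d_t U) /\ Ck k' (d_th U)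
  end.

Definition smooth2 (U : R -> R -> R) : Prop := forall k, Ck k U.

Definition periodic (f : R -> R) : Prop := forall x, f (x + 2 * PI) = f x.

(* A Riemannian metric E dt^2 + 2 F dt dth + G dth^2 on [0, T] x S^1, given by
   its coefficients; S^1 = R / 2 PI Z.  Only the values of the coefficients
   at 0 <= t <= T matter below. *)
Record metric := Metric { gE : R -> R -> R; gF : R -> R -> R; gG : R -> R -> R }.

Definition gdet (g : metric) (t th : R) : R := gE g t th * gG g t th - (gF g t th) ^ 2.

Definition grad_t (g : metric) (U : R -> R -> R) (t th : R) : R :=
  (gG g t th * d_t U t th - gF g t th * d_th U t th) / gdet g t th.
Definition grad_th (g : metric) (U : R -> R -> R) (t th : R) : R :=
  (gE g t th * d_th U t th - gF g t th * d_t U t th) / gdet g t th.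

Definition laplace_beltrami (g : metric) (U : R -> R -> R) (t th : R) : R :=
  (d_t (fun s r => sqrt (gdet g s r) * grad_t g U s r) t th
   + d_th (fun s r => sqrt (gdet g s r) * grad_th g U s r) t th)
  / sqrt (gdet g t th).

(* The boundary components {0} x S^1 and {T} x S^1 are indexed by false and
   true; a function on the boundary is a pair of 2 PI-periodic functions. *)
Definition bfun := bool -> R -> R.

Definition edge (T : R) (b : bool) : R := if b then T else 0.

Definition smooth_bfun (u : bfun) : Prop :=
  forall b, smooth1 (u b) /\ periodic (u b).

(* The outward unit normal is (grad t) / |grad t| at t = T and its opposite at
   t = 0, and |grad t|^2 = g^{tt} = G / det g. *)
Definition normal_derivative (g : metric) (T : R) (U : R -> R -> R) (b : bool) (th : R) : R :=
  (if b then 1 else -1) * grad_t g U (edge T b) th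
  / sqrt (gG g (edge T b) th / gdet g (edge T b) th).

(* A smooth function on the compact cylinder is the restriction to [0, T] of a
   smooth function on R x S^1. *)
Definition harmonic_extension (g : metric) (T : R) (u : bfun) (U : R -> R -> R) : Prop :=
  smooth2 U
  /\ (forall t, periodic (U t))
  /\ (forall t th, 0 < t < T -> laplace_beltrami g U t th = 0)
  /\ (forall b th, U (edge T b) th = u b th).

Definition DtN (g : metric) (T : R) (u v : bfun) : Prop :=
  exists U, harmonic_extension g T u U
            /\ forall b th, v b th = normal_derivative g T U b th.

Definition steklov_eigenspace (g : metric) (T s : R) (u : bfun) : Prop :=
  smooth_bfun u /\ DtN g T u (fun b th => s * u b th).

(* sum_n_m a 1 m is the empty sum when m = 0. *)
Definition lincomb (m : nat) (c : nat -> R) (e : nat -> bfun) : bfun :=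
  fun b th => sum_n_m (fun i => c i * e i b th) 1 m.

Definition has_dim (E : bfun -> Prop) (m : nat) : Prop :=
  exists e : nat -> bfun,
    (forall i, (1 <= i <= m)%nat -> E (e i))
    /\ (forall c : nat -> R, (forall b th, lincomb m c e b th = 0) ->
          forall i, (1 <= i <= m)%nat -> c i = 0)
    /\ (forall u, E u -> exists c : nat -> R, forall b th, u b th = lincomb m c e b th).

Definition has_card (P : nat -> Prop) (m : nat) : Prop :=
  exists l : list nat, NoDup l /\ length l = m /\ forall i, In i l <-> P i.

Definition steklov_spectrum (g : metric) (T : R) (sigma : nat -> R) : Prop :=
  (forall k, sigma k <= sigma (S k))
  /\ (forall s, exists m, has_dim (steklov_eigenspace g T s) m
                          /\ has_card (fun k => sigma k = s) m).

Definition steklov (g : metric) (T : R) : nat -> R :=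
  epsilon (inhabits (fun _ => 0)) (steklov_spectrum g T).

Definition boundary_length (g : metric) (T : R) : R :=
  RInt (fun th => sqrt (gG g 0 th)) 0 (2 * PI) + RInt (fun th => sqrt (gG g T th)) 0 (2 * PI).

Definition normalized_steklov (k : nat) (g : metric) (T : R) : R :=
  steklov g T k * boundary_length g T.

Definition smooth_on (T : R) (f : R -> R) : Prop :=
  exists F, smooth1 F /\ forall t, 0 <= t <= T -> F t = f t.

Definition rotationally_symmetric (g : metric) (T : R) : Prop :=
  exists f : R -> R,
    smooth_on T f
    /\ (forall t, 0 <= t <= T -> 0 < f t)
    /\ (forall t th, 0 <= t <= T ->
          gE g t th = (f t) ^ 2 /\ gF g t th = 0 /\ gG g t th = (f t) ^ 2).

Definition maximizes_normalized_steklov (k : nat) (g : metric) (T : R) : Prop :=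
  0 < T /\ rotationally_symmetric g T
  /\ forall g' T', 0 < T' -> rotationally_symmetric g' T' ->
       normalized_steklov k g' T' <= normalized_steklov k g T.

Inductive coord := x1 | x2 | x3 | x4.

Definition vec4 := coord -> R.

Definition dot (v w : vec4) : R := v x1 * w x1 + v x2 * w x2 + v x3 * w x3 + v x4 * w x4.

Definition map4 := coord -> R -> R -> R.

Definition pt (X : map4) (t th : R) : vec4 := fun i => X i t th.
Definition X_t (X : map4) (t th : R) : vec4 := fun i => d_t (X i) t th.
Definition X_th (X : map4) (t th : R) : vec4 := fun i => d_th (X i) t th.

Definition induced_metric (X : map4) : metric :=
  Metric (fun t th => dot (X_t X t th) (X_t X t th))
         (fun t th => dot (X_t X t th) (X_th X t th))
         (fun t th => dot (X_th X t th) (X_th X t th)).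

Definition translate (X : map4) (t0 : R) : map4 := fun i t th => X i (t + t0) th.

Definition immersion (X : map4) (a b : R) : Prop :=
  (forall i, smooth2 (X i))
  /\ (forall i t, periodic (X i t))
  /\ forall t th, a <= t <= b ->
       forall p q, (forall i, p * X_t X t th i + q * X_th X t th i = 0) -> p = 0 /\ q = 0.

(* The Moebius band is the quotient of the cylinder [-a, a] x S^1 by the
   orientation-reversing involution (t, th) |-> (-t, th + PI). *)
Definition factors_through_moebius (X : map4) : Prop :=
  forall i t th, X i (- t) (th + PI) = X i t th.

(* At X(t, th), the vectors tangent to the surface and normal to its boundary
   curve are normal to the sphere centred at the origin. *)
Definition orthogonal_to_sphere_at (X : map4) (t th : R) : Prop :=
  forall p q : R,
    let v := fun i => p * X_t X t th i + q * X_th X t th i in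
    dot v (X_th X t th) = 0 ->
    forall w : vec4, dot w (pt X t th) = 0 -> dot v w = 0.

Definition meets_ball_orthogonally (X : map4) (a b : R) : Prop :=
  exists r, 0 < r
    /\ forall t th, t = a \/ t = b ->
         dot (pt X t th) (pt X t th) = r ^ 2 /\ orthogonal_to_sphere_at X t th.

Definition coth (x : R) : R := cosh x / sinh x.

(* The number T_{k,1}(1); meaningful for k >= 2, as tanh < 1 < coth leaves no
   root when k = 1. *)
Definition T_k1 (k : nat) : R :=
  epsilon (inhabits 0)
    (unique (fun s => 0 < s /\ INR k * tanh (INR k * s / 2) = coth (s / 2))).

Definition moebius (n : nat) : map4 := fun i t th =>
  match i with
  | x1 => 2 * INR n * sinh t * cos th
  | x2 => 2 * INR n * sinh t * sin th
  | x3 => cosh (2 * INR n * t) * cos (2 * INR n * th)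
  | x4 => cosh (2 * INR n * t) * sin (2 * INR n * th)
  end.

(* Main.v *)
Require Import Defs.
From Stdlib Require Import ZArith Reals List Lia Lra FunctionalExtensionality ClassicalEpsilon.
From Coquelicot Require Import Coquelicot.
Open Scope R_scope.

(** Why the theorem holds.

    On a cylinder with metric f(t)^2 (dt^2 + dth^2) harmonicity is that of the flat
    metric, and only a = f(0) and b = f(T) enter the Steklov condition.  Expanding in
    Fourier modes of frequency k, the problem becomes U'' = k^2 U on [0, T] with
    -U'(0) = s a U(0) and U'(T) = s b U(T), which is solvable exactly when s is a root
    of an explicit quadratic; it has two distinct real roots s_k^- < s_k^+.  Hence the
    eigenvalues are labelled by a trigonometric function (one for k = 0, two for each
    k >= 1) together with a sign, each label carrying one eigenfunction.  That these
    eigenfunctions exhaust an eigenspace is the completeness of the Fourier system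
    (fourier_complete), and flat_has_dim is the resulting count of multiplicities.
    Since the sequence of eigenvalues is pinned down only by multiplicities, the
    spectrum is produced by sorting the labels (sort_enumeration), and afterwards
    bounded by counting: steklov_le and steklov_ge.

    Put m = 2n and let x = T_{m,1}(1)/2, so that m tanh (m x) = coth x =: c.
    The claim is that the maximum is 4 pi c.

    Upper bound.  As the boundary has length 2 pi (a + b), one needs 4n + 1 labels with
    eigenvalue at most s = 2c/(a + b).  Pair the frequencies k and j = m + 1 - k for
    n < k <= m.  The roots s_j^- lie below s (steklov_root_false_low), so does s_0^- = 0, and
    it is enough that s_k^- <= s or s_j^+ <= s (roots_not_both_large): this gives
    1 + 2n + 2n labels.  If T <= 2x then s_k^- <= s, because
    s_k^- <= 2k tanh (kT/2)/(a + b).  If T >= 2x and both roots exceeded s, eliminating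
    the product ab between the two quadratics would give
    2c (k coth kT - j coth jT) < k^2 - j^2.
    The opposite inequality is critical_gap: the divided difference of the even
    function u coth (uT) of u over [j, k], divided by k + j = m + 1, increases when
    the symmetric pair (j, k) moves inwards from (1, m), and k coth kT - j coth jT
    increases with T; at T = 2x and (j, k) = (1, m) there is equality.

    Lower bound.  For a = b the roots are k tanh (kT/2)/a and k coth (kT/2)/a.  At
    T = 2x those below c/a are the smaller roots of frequency k < m, and the larger root
    of frequency 0: that makes 1 + 2 (m - 1) + 1 = 4n labels, so the eigenvalue of
    index 4n is at least c/a.

    The metric induced by the Moebius immersion is conformal to the flat one, with a
    factor even in t, so that a = b; and the equation m tanh (m x) = coth x also says
    that X_t is a multiple of X on the boundary, which is the orthogonality to the
    sphere. *)

(** * Hyperbolic functions and the divided differences of k coth (k T) *)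

Lemma derive_nonneg_incr (f df : R -> R) (a b : R) :
  a <= b ->
  (forall x, a <= x <= b -> is_derive f x (df x)) ->
  (forall x, a <= x <= b -> 0 <= df x) ->
  f a <= f b.
Proof.
  intros Hab Hd Hp.
  destruct (MVT_gen f a b df) as [c [Hc Heq]]; rewrite ?Rmin_left, ?Rmax_right in * by lra.
  - intros x Hx; apply Hd; lra.
  - intros x Hx. apply continuity_pt_filterlim, (ex_derive_continuous f).
    exists (df x); apply Hd; lra.
  - specialize (Hp c Hc). nra.
Qed.

Lemma cosh_pos x : 0 < cosh x.
Proof. unfold cosh; generalize (exp_pos x) (exp_pos (- x)); lra. Qed.

Lemma cosh2_sinh2 x : cosh x * cosh x = 1 + sinh x * sinh x.
Proof.
  unfold cosh, sinh.
  assert (H : exp x * exp (- x) = 1) by (rewrite <- exp_plus, Rplus_opp_r; apply exp_0).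
  nra.
Qed.

Lemma sinh_opp x : sinh (- x) = - sinh x.
Proof. unfold sinh; rewrite Ropp_involutive; lra. Qed.

Lemma cosh_opp x : cosh (- x) = cosh x.
Proof. unfold cosh; rewrite Ropp_involutive; lra. Qed.

Lemma sinh_add x y : sinh (x + y) = sinh x * cosh y + cosh x * sinh y.
Proof. unfold sinh, cosh; rewrite Ropp_plus_distr, !exp_plus; field. Qed.

Lemma cosh_add x y : cosh (x + y) = cosh x * cosh y + sinh x * sinh y.
Proof. unfold sinh, cosh; rewrite Ropp_plus_distr, !exp_plus; field. Qed.

Lemma sinh_pos x : 0 < x -> 0 < sinh x.
Proof. intros H; rewrite <- sinh_0; now apply sinh_lt. Qed.

Lemma sinh_nonneg x : 0 <= x -> 0 <= sinh x.
Proof. intros [H | <-]; [apply Rlt_le, sinh_pos, H | rewrite sinh_0; lra]. Qed.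

Lemma cosh_ge_1 x : 1 <= cosh x.
Proof. generalize (cosh2_sinh2 x) (cosh_pos x); nra. Qed.

Lemma cosh_incr x y : 0 <= x <= y -> cosh x <= cosh y.
Proof.
  intros H. apply (derive_nonneg_incr cosh sinh); try lra.
  - intros z _; auto_derive; auto; ring.
  - intros z Hz; apply sinh_nonneg; lra.
Qed.

Lemma cosh_lt x y : 0 <= x < y -> cosh x < cosh y.
Proof.
  intros H. assert (Hs := sinh_lt x y (proj2 H)).
  assert (H0 := sinh_nonneg x (proj1 H)).
  generalize (cosh2_sinh2 x) (cosh2_sinh2 y) (cosh_pos x) (cosh_pos y); nra.
Qed.

Lemma tanh_pos x : 0 < x -> 0 < tanh x.
Proof. intros H; apply Rdiv_lt_0_compat; [now apply sinh_pos | apply cosh_pos]. Qed.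

Lemma tanh_lt_1 x : tanh x < 1.
Proof.
  unfold tanh. apply (Rmult_lt_reg_r (cosh x)); [apply cosh_pos|].
  field_simplify; [| generalize (cosh_pos x); lra].
  unfold sinh, cosh; generalize (exp_pos (- x)); lra.
Qed.

Lemma tanh_lt x y : x < y -> tanh x < tanh y.
Proof.
  intros H. assert (Hs : 0 < sinh (y - x)) by (apply sinh_pos; lra).
  unfold Rminus in Hs; rewrite sinh_add, sinh_opp, cosh_opp in Hs.
  assert (Hx := cosh_pos x); assert (Hy := cosh_pos y). unfold tanh.
  apply (Rmult_lt_reg_r (cosh x * cosh y)); [now apply Rmult_lt_0_compat|].
  field_simplify; lra.
Qed.

Lemma tanh_le x y : x <= y -> tanh x <= tanh y.
Proof. intros [H | ->]; [left; now apply tanh_lt | right; reflexivity]. Qed.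

Lemma coth_tanh x : 0 < x -> coth x = / tanh x.
Proof.
  intros H; unfold coth, tanh; field.
  generalize (sinh_pos x H) (cosh_pos x); lra.
Qed.

Lemma sinh_le_mul_cosh x : 0 <= x -> sinh x <= x * cosh x.
Proof.
  intros H.
  assert (G := derive_nonneg_incr (fun z => z * cosh z - sinh z) (fun z => z * sinh z) 0 x H).
  cbv beta in G; rewrite sinh_0 in G. cut (0 * cosh 0 - 0 <= x * cosh x - sinh x); [lra|]. apply G.
  - intros z _; auto_derive; auto; ring.
  - intros z Hz; apply Rmult_le_pos; [lra | apply sinh_nonneg; lra].
Qed.

(** Up to a positive factor and with z = 2q, this is minus the derivative of
    sinhc_cosh_slope.  All its derivatives at 0 up to the third vanish, and its third
    derivative z cosh z - sinh z is nonnegative. *)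
Lemma sinhc_cosh_slope_derivative_sign z : 0 <= z -> 0 <= z * sinh z + z * z - 4 * cosh z + 4.
Proof.
  intros H.
  assert (H2 : forall y, 0 <= y -> 0 <= y * sinh y + 2 - 2 * cosh y).
  { intros y Hy.
    assert (G := derive_nonneg_incr (fun z => z * sinh z + 2 - 2 * cosh z)
                   (fun z => z * cosh z - sinh z) 0 y Hy).
    cbv beta in G; rewrite sinh_0, cosh_0 in G. cut (0 * 0 + 2 - 2 * 1 <= y * sinh y + 2 - 2 * cosh y); [lra|].
    apply G.
    - intros x _; auto_derive; auto; ring.
    - intros x Hx; generalize (sinh_le_mul_cosh x (proj1 Hx)); lra. }
  assert (H1 : forall y, 0 <= y -> 0 <= y * cosh y + 2 * y - 3 * sinh y).
  { intros y Hy.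
    assert (G := derive_nonneg_incr (fun z => z * cosh z + 2 * z - 3 * sinh z)
                   (fun z => z * sinh z + 2 - 2 * cosh z) 0 y Hy).
    cbv beta in G; rewrite sinh_0, cosh_0 in G. cut (0 * 1 + 2 * 0 - 3 * 0 <= y * cosh y + 2 * y - 3 * sinh y); [lra|].
    apply G.
    - intros x _; auto_derive; auto; ring.
    - intros x Hx; apply H2; lra. }
  assert (G := derive_nonneg_incr (fun z => z * sinh z + z * z - 4 * cosh z + 4)
                 (fun z => z * cosh z + 2 * z - 3 * sinh z) 0 z H).
  cbv beta in G; rewrite sinh_0, cosh_0 in G. cut (0 * 0 + 0 * 0 - 4 * 1 + 4 <= z * sinh z + z * z - 4 * cosh z + 4); [lra|].
  apply G.
  - intros x _; auto_derive; auto; ring.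
  - intros x Hx; apply H1; lra.
Qed.

(** The slope of the curve q |-> (cosh q, sinh q / q). *)
Definition sinhc_cosh_slope (q : R) : R := (q * cosh q - sinh q) / (q ^ 2 * sinh q).

(** The curve (cosh q, sinh q / q) is concave. *)
Lemma sinhc_cosh_slope_decr q r : 0 < q <= r -> sinhc_cosh_slope r <= sinhc_cosh_slope q.
Proof.
  intros H. cut (- sinhc_cosh_slope q <= - sinhc_cosh_slope r); [lra|].
  apply (derive_nonneg_incr (fun x => - sinhc_cosh_slope x)
     (fun x => (x * cosh x * sinh x + x ^ 2 - 2 * sinh x ^ 2) / (x ^ 3 * sinh x ^ 2))); try lra.
  - intros x Hx. assert (Hs : 0 < sinh x) by (apply sinh_pos; lra).
    unfold sinhc_cosh_slope. auto_derive.
    + assert (0 < x * (x * 1) * sinh x) by (apply Rmult_lt_0_compat; nra). lra.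
    + field_simplify; [|split; lra..].
      replace (cosh x ^ 2) with (1 + sinh x ^ 2) by (generalize (cosh2_sinh2 x); lra).
      field; split; lra.
  - intros x Hx. assert (Hs : 0 < sinh x) by (apply sinh_pos; lra).
    apply Rdiv_le_0_compat.
    + assert (G := sinhc_cosh_slope_derivative_sign (2 * x)). replace (2 * x) with (x + x) in G by ring.
      rewrite sinh_add, cosh_add in G. generalize (cosh2_sinh2 x); nra.
    + apply Rmult_lt_0_compat; apply pow_lt; lra.
Qed.

(** Chords of a concave curve ending at a fixed point get flatter as the other end
    moves towards it.  With l the slope at q2, the function sinh q / q - l cosh q
    increases up to q2 and decreases afterwards; comparing its values at q1, q2 and P
    gives the inequality. *)
Lemma sinhc_cosh_chord q1 q2 P : 0 < q1 <= q2 -> q2 < P ->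
  (sinh P / P - sinh q2 / q2) * (cosh P - cosh q1)
    <= (sinh P / P - sinh q1 / q1) * (cosh P - cosh q2).
Proof.
  intros H1 H2. set (l := sinhc_cosh_slope q2).
  assert (D : forall x, 0 < x -> is_derive (fun x => sinh x / x - l * cosh x) x
                (sinh x * (sinhc_cosh_slope x - l))).
  { intros x Hx. assert (Hs := sinh_pos x Hx). unfold sinhc_cosh_slope. auto_derive; [lra|]. field; split; lra. }
  assert (A : sinh q1 / q1 - l * cosh q1 <= sinh q2 / q2 - l * cosh q2).
  { apply (derive_nonneg_incr (fun x => sinh x / x - l * cosh x)
             (fun x => sinh x * (sinhc_cosh_slope x - l))); try lra.
    - intros x Hx; apply D; lra.
    - intros x Hx; apply Rmult_le_pos; [apply sinh_nonneg; lra|].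
      generalize (sinhc_cosh_slope_decr x q2 ltac:(lra)); unfold l; lra. }
  assert (B : - (sinh q2 / q2 - l * cosh q2) <= - (sinh P / P - l * cosh P)).
  { apply (derive_nonneg_incr (fun x => - (sinh x / x - l * cosh x))
             (fun x => - (sinh x * (sinhc_cosh_slope x - l)))); try lra.
    - intros x Hx; apply (is_derive_opp (fun x => sinh x / x - l * cosh x)), D; lra.
    - intros x Hx. rewrite Ropp_mult_distr_r. apply Rmult_le_pos; [apply sinh_nonneg; lra|].
      generalize (sinhc_cosh_slope_decr q2 x ltac:(lra)); unfold l; lra. }
  assert (C1 : cosh q1 <= cosh q2) by (apply cosh_incr; lra).
  assert (C2 : cosh q2 <= cosh P) by (apply cosh_incr; lra).
  set (u1 := sinh q1 / q1) in *; set (u2 := sinh q2 / q2) in *; set (u := sinh P / P) in *.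
  nra.
Qed.

(** The derivative of k coth (k t) in t is - (k / sinh (k t))^2, and
    k / sinh (k t) decreases in k because sinh (x t) / x increases in x. *)
Lemma coth_gap_incr j k S T : 0 < j <= k -> 0 < S <= T ->
  k * coth (k * S) - j * coth (j * S) <= k * coth (k * T) - j * coth (j * T).
Proof.
  intros Hjk HS.
  apply (derive_nonneg_incr (fun t => k * coth (k * t) - j * coth (j * t))
           (fun t => (j / sinh (j * t)) ^ 2 - (k / sinh (k * t)) ^ 2)); try lra.
  - intros t Ht. assert (0 < sinh (j * t)) by (apply sinh_pos; nra).
    assert (0 < sinh (k * t)) by (apply sinh_pos; nra).
    unfold coth. auto_derive; [lra|]. 
    field_simplify; [|split; lra..].
    replace (cosh (j * t) ^ 2) with (1 + sinh (j * t) ^ 2) by (generalize (cosh2_sinh2 (j * t)); lra).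
    replace (cosh (k * t) ^ 2) with (1 + sinh (k * t) ^ 2) by (generalize (cosh2_sinh2 (k * t)); lra).
    field; split; lra.
  - intros t Ht. assert (Hj : 0 < sinh (j * t)) by (apply sinh_pos; nra).
    assert (Hk : 0 < sinh (k * t)) by (apply sinh_pos; nra).
    cut (k / sinh (k * t) <= j / sinh (j * t)).
    { intros G. assert (0 < k / sinh (k * t)) by (apply Rdiv_lt_0_compat; lra). nra. }
    cut (sinh (j * t) / j <= sinh (k * t) / k).
    { intros G. replace (k / sinh (k * t)) with (/ (sinh (k * t) / k)) by (field; lra).
      replace (j / sinh (j * t)) with (/ (sinh (j * t) / j)) by (field; lra).
      apply Rinv_le_contravar; [apply Rdiv_lt_0_compat; lra | exact G]. }
    apply (derive_nonneg_incr (fun x => sinh (x * t) / x)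
             (fun x => (x * t * cosh (x * t) - sinh (x * t)) / x ^ 2)); try lra.
    + intros x Hx. auto_derive; [lra|]. field; lra.
    + intros x Hx. apply Rdiv_le_0_compat; [| apply pow_lt; lra].
      generalize (sinh_le_mul_cosh (x * t) ltac:(nra)); lra.
Qed.

(** Sum-to-product formulas turn a divided difference of u coth (u T) over [j, k] into
    the slope of a chord of the curve (cosh q, sinh q / q), whose end points are governed
    by k + j and k - j; hence pairs with a common sum share one end of the chord. *)
Lemma coth_gap_sum_prod j k T : 0 < j < k -> 0 < T ->
  k * coth (k * T) - j * coth (j * T) =
  (k ^ 2 - j ^ 2) * T *
    ((sinh ((k + j) * T) / ((k + j) * T) - sinh ((k - j) * T) / ((k - j) * T))
       / (cosh ((k + j) * T) - cosh ((k - j) * T))).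
Proof.
  intros Hjk HT.
  assert (Hj : 0 < sinh (j * T)) by (apply sinh_pos; nra).
  assert (Hk : 0 < sinh (k * T)) by (apply sinh_pos; nra).
  replace ((k + j) * T) with (k * T + j * T) at 1 3 by ring.
  replace ((k - j) * T) with (k * T + - (j * T)) at 1 3 by ring.
  rewrite !sinh_add, !cosh_add, sinh_opp, cosh_opp. unfold coth.
  field. repeat split; nra.
Qed.

(** Among the pairs with sum m + 1, the divided difference of u coth (u T) is smallest
    for the outermost pair (1, m). *)
Lemma coth_gap_symmetric j k m T : 0 < T -> 1 <= j < k -> j + k = m + 1 -> 
  (k ^ 2 - j ^ 2) * (m * coth (m * T) - coth T)
    <= (m ^ 2 - 1) * (k * coth (k * T) - j * coth (j * T)).
Proof.
  intros HT Hjk Hm.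
  replace (coth T) with (1 * coth (1 * T)) by now rewrite !Rmult_1_l.
  rewrite (coth_gap_sum_prod j k T), (coth_gap_sum_prod 1 m T) by lra.
  replace (k + j) with (m + 1) by lra.
  assert (G := sinhc_cosh_chord ((k - j) * T) ((m - 1) * T) ((m + 1) * T)
                 ltac:(nra) ltac:(nra)).
  set (P := (m + 1) * T) in *; set (q1 := (k - j) * T) in *; set (q2 := (m - 1) * T) in *.
  assert (C1 : cosh q1 < cosh P) by (apply cosh_lt; unfold P, q1; nra).
  assert (C2 : cosh q2 < cosh P) by (apply cosh_lt; unfold P, q2; nra).
  set (u := sinh P / P) in *; set (u1 := sinh q1 / q1) in *; set (u2 := sinh q2 / q2) in *.
  assert (E : (u - u2) / (cosh P - cosh q2) <= (u - u1) / (cosh P - cosh q1)).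
  { apply (Rmult_le_reg_r ((cosh P - cosh q2) * (cosh P - cosh q1))).
    - apply Rmult_lt_0_compat; lra.
    - field_simplify; lra. }
  replace ((k ^ 2 - j ^ 2) * ((m ^ 2 - 1 ^ 2) * T * ((u - u2) / (cosh P - cosh q2))))
    with ((k ^ 2 - j ^ 2) * (m ^ 2 - 1) * T * ((u - u2) / (cosh P - cosh q2))) by ring.
  replace ((m ^ 2 - 1) * ((k ^ 2 - j ^ 2) * T * ((u - u1) / (cosh P - cosh q1))))
    with ((k ^ 2 - j ^ 2) * (m ^ 2 - 1) * T * ((u - u1) / (cosh P - cosh q1))) by ring.
  apply Rmult_le_compat_l; [| exact E].
  apply Rmult_le_pos; [apply Rmult_le_pos|]; nra.
Qed.

(** * The root T_k1 and the Steklov eigenvalues of one Fourier mode *)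

Lemma le_sinh x : 0 <= x -> x <= sinh x.
Proof.
  intros H. assert (G := derive_nonneg_incr (fun z => sinh z - z) (fun z => cosh z - 1) 0 x H).
  cbv beta in G. rewrite sinh_0 in G. cut (0 - 0 <= sinh x - x); [lra|]. apply G.
  - intros z _; auto_derive; auto; ring.
  - intros z _; generalize (cosh_ge_1 z); lra.
Qed.

Lemma mul_coth_incr x v w : 0 < x -> 0 < v <= w -> v * coth (v * x) <= w * coth (w * x).
Proof.
  intros Hx Hvw.
  apply (derive_nonneg_incr (fun w => w * coth (w * x))
    (fun w => (sinh (w * x) * cosh (w * x) - w * x) / sinh (w * x) ^ 2)); try lra.
  - intros z Hz. assert (0 < sinh (z * x)) by (apply sinh_pos; nra).
    unfold coth. auto_derive; [lra|]. field_simplify; [|lra..].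
    replace (cosh (z * x) ^ 2) with (1 + sinh (z * x) ^ 2) by (generalize (cosh2_sinh2 (z * x)); lra).
    field; lra.
  - intros z Hz. assert (0 < sinh (z * x)) by (apply sinh_pos; nra).
    apply Rdiv_le_0_compat; [| apply pow_lt; lra].
    generalize (le_sinh (z * x) ltac:(nra)) (cosh_ge_1 (z * x)); nra.
Qed.

Lemma tanh_exp x : tanh x = (exp (2 * x) - 1) / (exp (2 * x) + 1).
Proof.
  unfold tanh, sinh, cosh. replace (2 * x) with (x + x) by ring. rewrite exp_plus, exp_Ropp.
  assert (H := exp_pos x). field. split; nra.
Qed.

Lemma tanh_mul_coth k x : 0 < x ->
  (k * tanh (k * x) = coth x <-> k * (tanh (k * x) * tanh x) = 1).
Proof.
  intros Hx; rewrite coth_tanh by easy. assert (H := tanh_pos x Hx). split; intros E.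
  - rewrite <- Rmult_assoc, E; field; lra.
  - apply (Rmult_eq_reg_r (tanh x)); [|lra]. rewrite Rmult_assoc, E; field; lra.
Qed.

(** The function k tanh (k s / 2) tanh (s / 2) increases strictly from 0, and exceeds 1
    at s = 6 because tanh 3 > 3/4; so the root exists and is unique. *)
Lemma T_k1_spec k : (2 <= k)%nat ->
  0 < T_k1 k /\ INR k * tanh (INR k * (T_k1 k / 2)) = coth (T_k1 k / 2).
Proof.
  intros Hk. assert (HK : 2 <= INR k) by (apply (le_INR 2) in Hk; exact Hk).
  set (K := INR k) in *.
  assert (Hu : exists x, unique (fun s => 0 < s /\ K * tanh (K * s / 2) = coth (s / 2)) x).
  { assert (He : exists s, 0 < s /\ K * (tanh (K * (s / 2)) * tanh (s / 2)) = 1).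
    { assert (Ht : 3 / 4 < tanh 3).
      { rewrite tanh_exp. assert (E := exp_ineq1 (2 * 3) ltac:(lra)).
        apply (Rmult_lt_reg_r (exp (2 * 3) + 1)); [lra|]. field_simplify; lra. }
      assert (Ht' : tanh 3 <= tanh (K * (6 / 2))) by (apply tanh_le; lra).
      destruct (IVT_gen (fun s => K * (tanh (K * (s / 2)) * tanh (s / 2))) 0 6 1) as [s [Hs Es]].
      - intros x. apply continuity_pt_filterlim,
          (ex_derive_continuous (fun s => K * (tanh (K * (s / 2)) * tanh (s / 2)))).
        unfold tanh. auto_derive. generalize (cosh_pos (x * / 2)) (cosh_pos (K * (x * / 2))). lra.
      - cbv beta. replace (0 / 2) with 0 by field. replace (6 / 2) with 3 in * by field.
        rewrite Rmult_0_r. replace (tanh 0) with 0 by (unfold tanh; rewrite sinh_0; field; generalize (cosh_pos 0); lra).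
        set (u := tanh (K * 3)) in *; set (v := tanh 3) in *.
        assert (Huv : 9 / 16 <= u * v) by nra.
        assert (HKuv : 1 <= K * (u * v)) by nra.
        rewrite Rmin_left, Rmax_right; lra.
      - rewrite Rmin_left, Rmax_right in Hs by lra. exists s; split; [| exact Es].
        destruct (Rle_lt_or_eq_dec 0 s (proj1 Hs)) as [?|<-]; [easy|]. exfalso.
        revert Es. replace (0 / 2) with 0 by field. rewrite Rmult_0_r.
        unfold tanh; rewrite sinh_0; unfold Rdiv; lra. }
    destruct He as [s [Hs Es]]. exists s. split.
    - split; [easy|]. replace (K * s / 2) with (K * (s / 2)) by field.
      apply tanh_mul_coth; lra.
    - intros s' [Hs' Es']. replace (K * s' / 2) with (K * (s' / 2)) in Es' by field.
      apply tanh_mul_coth in Es'; [|lra].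
      assert (Hlt : forall u v, 0 < u < v ->
        K * (tanh (K * (u / 2)) * tanh (u / 2)) < K * (tanh (K * (v / 2)) * tanh (v / 2))).
      { intros u v Huv. apply Rmult_lt_compat_l; [lra|].
        assert (0 < tanh (K * (u / 2))) by (apply tanh_pos; nra).
        assert (0 < tanh (u / 2)) by (apply tanh_pos; lra).
        assert (tanh (u / 2) < tanh (v / 2)) by (apply tanh_lt; lra).
        assert (tanh (K * (u / 2)) < tanh (K * (v / 2))) by (apply tanh_lt; nra).
        nra. }
      destruct (Rtotal_order s s') as [H | [H | H]]; [| easy |];
        [specialize (Hlt s s') | specialize (Hlt s' s)]; lra. }
  assert (Hs := epsilon_spec (inhabits 0) _ Hu).
  change (epsilon (inhabits 0) _) with (T_k1 k) in Hs.
  destruct Hs as [[H0 H1] _]. split; [easy|].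
  replace (K * (T_k1 k / 2)) with (K * T_k1 k / 2) by field. exact H1.
Qed.

(** With y = m x the equation gives y tanh y = x coth x >= 1.  As tanh < 1 this forces
    y > 1, whence tanh y >= 1/2. *)
Lemma critical_value_ge m x : 2 <= m -> 0 < x -> m * tanh (m * x) = coth x ->
  m <= 2 * coth x.
Proof.
  intros Hm Hx E.
  assert (Hy : 1 <= m * x * tanh (m * x)).
  { replace (m * x * tanh (m * x)) with (x * coth x) by (rewrite <- E; ring).
    unfold coth. assert (Hs := sinh_pos x Hx).
    apply (Rmult_le_reg_r (sinh x)); [easy|]. field_simplify; [|lra].
    generalize (sinh_le_mul_cosh x (Rlt_le _ _ Hx)); lra. }
  assert (H0 : 0 < m * x) by nra.
  assert (H1 : 1 < m * x) by (generalize (tanh_lt_1 (m * x)); revert Hy H0; generalize (tanh (m * x)) (m * x); intros; nra).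
  cut (1 / 2 <= tanh (m * x)); [nra|].
  rewrite tanh_exp. assert (G := exp_ineq1 (2 * (m * x)) ltac:(nra)).
  apply (Rmult_le_reg_r (exp (2 * (m * x)) + 1)); [lra|]. field_simplify; lra.
Qed.

(** At T = 2x the doubling formula coth 2y = (coth y + tanh y) / 2 makes the gap
    m coth (m T) - coth T equal to (m^2 - 1) / (2 coth x).  The two monotonicity
    properties of the gap carry this over to larger T and to inner pairs. *)
Lemma critical_gap m x j k T : 2 <= m -> 0 < x -> m * tanh (m * x) = coth x ->
  2 * x <= T -> 1 <= j < k -> j + k = m + 1 ->
  k ^ 2 - j ^ 2 <= 2 * coth x * (k * coth (k * T) - j * coth (j * T)).
Proof.
  intros Hm Hx E HT Hjk Hs.
  assert (G := coth_gap_symmetric j k m T ltac:(lra) Hjk Hs).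
  assert (I := coth_gap_incr 1 m (2 * x) T ltac:(lra) ltac:(lra)).
  rewrite !Rmult_1_l in I.
  assert (D : forall y, 0 < y -> coth (2 * y) = (/ tanh y + tanh y) / 2).
  { intros y Hy. unfold coth, tanh. replace (2 * y) with (y + y) by ring.
    rewrite sinh_add, cosh_add. field. generalize (cosh_pos y) (sinh_pos y Hy); nra. }
  replace (m * (2 * x)) with (2 * (m * x)) in I by ring.
  rewrite !D in I by nra.
  assert (Hc : coth x = / tanh x) by now apply coth_tanh.
  assert (Tx := tanh_pos x Hx). assert (Tm := tanh_pos (m * x) ltac:(nra)).
  set (c := coth x) in *.
  replace (tanh x) with (/ c) in * by (rewrite Hc; field; lra).
  replace (tanh (m * x)) with (c / m) in * by (rewrite <- E; field; lra).
  assert (Cp : 0 < c) by (apply Rinv_0_lt_compat in Tx; rewrite Rinv_inv in Tx; lra).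
  replace (m * ((/ (c / m) + c / m) / 2) - (/ / c + / c) / 2) with ((m ^ 2 - 1) / (2 * c)) in I
    by (field; split; lra).
  apply (Rmult_le_reg_l (m ^ 2 - 1)); [nra|].
  apply Rle_trans with (2 * c * ((k ^ 2 - j ^ 2) * (m * coth (m * T) - coth T))).
  - replace ((m ^ 2 - 1) * (k ^ 2 - j ^ 2)) with (2 * c * ((k ^ 2 - j ^ 2) * ((m ^ 2 - 1) / (2 * c))))
      by (field; lra).
    apply Rmult_le_compat_l; [lra|]. apply Rmult_le_compat_l; [nra|]. exact I.
  - replace ((m ^ 2 - 1) * (2 * c * (k * coth (k * T) - j * coth (j * T))))
      with (2 * c * ((m ^ 2 - 1) * (k * coth (k * T) - j * coth (j * T)))) by ring.
    apply Rmult_le_compat_l; [lra|]. exact G.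
Qed.

(** The solution of u'' = w^2 u with u(0) = 0 and u'(0) = 1, so that frequency 0 needs
    no separate treatment. *)
Definition shc (w t : R) : R := if Req_EM_T w 0 then t else sinh (w * t) / w.

Lemma shc_derive w t : is_derive (shc w) t (cosh (w * t)).
Proof.
  unfold shc; destruct (Req_EM_T w 0) as [-> | H].
  - rewrite Rmult_0_l, cosh_0. apply (is_derive_id t).
  - auto_derive; [easy|]. field; easy.
Qed.

Lemma cosh_derive_shc w t : is_derive (fun t => cosh (w * t)) t (w ^ 2 * shc w t).
Proof.
  unfold shc; destruct (Req_EM_T w 0) as [-> | H]; auto_derive; auto; [ring | field; easy].
Qed.

Lemma cosh2_shc2 w t : cosh (w * t) ^ 2 = 1 + w ^ 2 * shc w t ^ 2.
Proof.
  generalize (cosh2_sinh2 (w * t)); unfold shc; destruct (Req_EM_T w 0) as [-> | H].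
  - rewrite Rmult_0_l, sinh_0; lra.
  - intros G. replace (w ^ 2 * (sinh (w * t) / w) ^ 2) with (sinh (w * t) ^ 2) by (field; easy). lra.
Qed.

Lemma shc_0 w : shc w 0 = 0.
Proof. unfold shc; destruct (Req_EM_T w 0); [easy|]. rewrite Rmult_0_r, sinh_0; now field. Qed.

Lemma shc_pos w t : 0 <= w -> 0 < t -> 0 < shc w t.
Proof.
  intros Hw Ht; unfold shc; destruct (Req_EM_T w 0); [easy|].
  apply Rdiv_lt_0_compat; [apply sinh_pos; nra | lra].
Qed.

(** The solutions of u'' = w^2 u with u'(T) = s b u(T) are the multiples of
    cosh (w (T - t)) - s b shc w (T - t); they satisfy u'(0) = - s a u(0) exactly when
    this quadratic in s vanishes. *)
Definition steklov_poly (a b T w s : R) : R :=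
  a * b * shc w T * s ^ 2 - (a + b) * cosh (w * T) * s + w ^ 2 * shc w T.

(** The sign of the square root is the boolean.  The discriminant is written as a sum of
    nonnegative terms, which makes it visible that the roots are real and distinct. *)
Definition steklov_root (a b T w : R) (sg : bool) : R :=
  ((a + b) * cosh (w * T)
    + (if sg then 1 else -1) * sqrt ((a - b) ^ 2 * cosh (w * T) ^ 2 + 4 * (a * b)))
  / (2 * (a * b * shc w T)).

Section Roots.
Variables a b T : R.
Hypotheses (Ha : 0 < a) (Hb : 0 < b) (HT : 0 < T).

Lemma steklov_poly_factor w s : 0 <= w ->
  steklov_poly a b T w s = a * b * shc w T * (s - steklov_root a b T w false) * (s - steklov_root a b T w true).
Proof.
  intros Hw. assert (Sp := shc_pos w T Hw HT). assert (E := cosh2_shc2 w T).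
  unfold steklov_poly, steklov_root. set (d := (a - b) ^ 2 * cosh (w * T) ^ 2 + 4 * (a * b)).
  assert (Hd : sqrt d ^ 2 = (a + b) ^ 2 * cosh (w * T) ^ 2 - 4 * (a * b) * w ^ 2 * shc w T ^ 2).
  { assert (0 < a * b) by now apply Rmult_lt_0_compat.
    assert (0 <= ((a - b) * cosh (w * T)) ^ 2) by apply pow2_ge_0.
    rewrite pow2_sqrt; unfold d; [rewrite E; ring | nra]. }
  replace (w ^ 2 * shc w T) with
    (((a + b) ^ 2 * cosh (w * T) ^ 2 - sqrt d ^ 2) / (4 * (a * b * shc w T)))
    by (rewrite Hd; field; repeat split; lra).
  field; repeat split; lra.
Qed.

Lemma steklov_root_lt w : 0 <= w -> steklov_root a b T w false < steklov_root a b T w true.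
Proof.
  intros Hw. assert (Sp := shc_pos w T Hw HT). unfold steklov_root.
  apply Rmult_lt_compat_r.
  - apply Rinv_0_lt_compat. repeat apply Rmult_lt_0_compat; lra.
  - assert (0 < sqrt ((a - b) ^ 2 * cosh (w * T) ^ 2 + 4 * (a * b))); [|lra].
    apply sqrt_lt_R0. assert (0 <= ((a - b) * cosh (w * T)) ^ 2) by apply pow2_ge_0.
    assert (0 < a * b) by now apply Rmult_lt_0_compat. nra.
Qed.

Lemma steklov_poly_lead_pos w : 0 <= w -> 0 < a * b * shc w T.
Proof. intros Hw; assert (Sp := shc_pos w T Hw HT). repeat apply Rmult_lt_0_compat; lra. Qed.

Lemma steklov_poly_root w sg : 0 <= w -> steklov_poly a b T w (steklov_root a b T w sg) = 0.
Proof. intros Hw; rewrite steklov_poly_factor by easy. destruct sg; ring. Qed.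

Lemma steklov_poly_eq_0 w s : 0 <= w -> steklov_poly a b T w s = 0 -> exists sg, s = steklov_root a b T w sg.
Proof.
  intros Hw; rewrite steklov_poly_factor by easy. assert (H := steklov_poly_lead_pos w Hw). intros E.
  apply Rmult_integral in E as [E | E]; [| exists true; lra].
  apply Rmult_integral in E as [E | E]; [lra | exists false; lra].
Qed.

Lemma steklov_poly_nonpos w s : 0 <= w -> steklov_poly a b T w s <= 0 ->
  steklov_root a b T w false <= s <= steklov_root a b T w true.
Proof.
  intros Hw; rewrite steklov_poly_factor by easy. assert (H := steklov_poly_lead_pos w Hw).
  assert (L := steklov_root_lt w Hw). intros E.
  assert (E' : (s - steklov_root a b T w false) * (s - steklov_root a b T w true) <= 0).
  { rewrite Rmult_assoc in E. nra. }
  split; apply Rnot_lt_le; intros ?; nra.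
Qed.

Lemma steklov_poly_pos_left w s : 0 <= w -> s < steklov_root a b T w false -> 0 < steklov_poly a b T w s.
Proof.
  intros Hw; rewrite steklov_poly_factor by easy. assert (H := steklov_poly_lead_pos w Hw).
  assert (L := steklov_root_lt w Hw). intros E. rewrite Rmult_assoc.
  apply Rmult_lt_0_compat; [easy|]. nra.
Qed.

Lemma steklov_root_false_0 : steklov_root a b T 0 false = 0.
Proof.
  unfold steklov_root. rewrite Rmult_0_l, cosh_0.
  replace ((a - b) ^ 2 * 1 ^ 2 + 4 * (a * b)) with ((a + b) ^ 2) by ring.
  rewrite sqrt_pow2 by lra. unfold Rdiv; ring.
Qed.

(** The value of the quadratic at the right-hand side is a nonpositive multiple of
    (a - b)^2, so there is equality when a = b. *)
Lemma steklov_root_false_le w : 0 < w -> steklov_root a b T w false <= 2 * (w * tanh (w * (T / 2))) / (a + b).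
Proof.
  intros Hw. apply steklov_poly_nonpos; [lra|]. unfold steklov_poly, shc.
  destruct (Req_EM_T w 0); [lra|].
  set (y := w * (T / 2)). assert (Hy : 0 < y) by (unfold y; apply Rmult_lt_0_compat; lra).
  replace (w * T) with (y + y) by (unfold y; field).
  rewrite sinh_add, cosh_add. assert (Cy := cosh_pos y). assert (Sy := sinh_pos y Hy). unfold tanh.
  match goal with |- ?l <= 0 => replace l with
    (- ((a - b) ^ 2 * (2 * w * sinh y ^ 3 / (cosh y * (a + b) ^ 2)))) by (field; repeat split; lra) end.
  apply Ropp_le_cancel; rewrite Ropp_0, Ropp_involutive.
  apply Rmult_le_pos; [apply pow2_ge_0|]. apply Rdiv_le_0_compat.
  - apply Rmult_le_pos; [lra|]. apply pow_le; lra.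
  - apply Rmult_lt_0_compat; [easy|]. apply pow_lt; lra.
Qed.

(** Dropping the nonnegative quadratic term from the equation of the root leaves
    (a + b) cosh (w T) s >= w^2 shc w T. *)
Lemma steklov_root_false_ge w : 0 < w -> w * tanh (w * T) / (a + b) <= steklov_root a b T w false.
Proof.
  intros Hw. assert (E := steklov_poly_root w false ltac:(lra)). assert (H := steklov_poly_lead_pos w ltac:(lra)).
  unfold steklov_poly in E. set (s := steklov_root a b T w false) in *.
  assert (Cy := cosh_pos (w * T)).
  assert (G : w ^ 2 * shc w T <= (a + b) * cosh (w * T) * s) by nra.
  unfold shc in G; destruct (Req_EM_T w 0); [lra|]. unfold tanh.
  apply (Rmult_le_reg_l ((a + b) * cosh (w * T))); [apply Rmult_lt_0_compat; lra|].
  replace ((a + b) * cosh (w * T) * (w * (sinh (w * T) / cosh (w * T)) / (a + b)))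
    with (w ^ 2 * (sinh (w * T) / w)) by (field; lra). exact G.
Qed.

(** Let s = 2 coth x / (a + b).  If T <= 2x the first alternative holds by
    steklov_root_false_le.  Otherwise, if both failed, the quadratic of frequency k would be
    positive at s and that of frequency j nonpositive; both contain the same term
    a b s^2, and subtracting contradicts critical_gap. *)
Lemma roots_not_both_large m x j k : 2 <= m -> 0 < x -> m * tanh (m * x) = coth x ->
  1 <= j -> j + 1 <= k -> k <= m -> j + k = m + 1 ->
  steklov_root a b T k false <= 2 * coth x / (a + b) \/ steklov_root a b T j true <= 2 * coth x / (a + b).
Proof.
  intros Hm Hx E H1j Hjk1 Hkm Hs. assert (Hjk : 1 <= j < k) by lra. set (c := coth x) in *.
  destruct (Rle_or_lt (steklov_root a b T k false) (2 * c / (a + b))) as [Hk | Hk]; [now left | right].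
  destruct (Rle_or_lt T (2 * x)) as [HTx | HTx].
  { exfalso; revert Hk; apply Rle_not_lt. apply Rle_trans with (1 := steklov_root_false_le k ltac:(lra)).
    apply Rmult_le_compat_r; [apply Rlt_le, Rinv_0_lt_compat; lra|].
    rewrite <- E. apply Rmult_le_compat_l; [lra|].
    apply Rmult_le_compat; try lra.
    - apply Rlt_le, tanh_pos. nra.
    - apply tanh_le. nra. }
  apply Rnot_lt_le; intros Hj.
  assert (Pk := steklov_poly_pos_left k _ ltac:(lra) Hk).
  assert (Hc := critical_value_ge m x Hm Hx E). fold c in Hc.
  (* Since s_j^- <= s < s_j^+, the quadratic of frequency j is nonpositive at s. *)
  assert (Jf : steklov_root a b T j false <= 2 * c / (a + b)).
  { apply Rle_trans with (1 := steklov_root_false_le j ltac:(lra)).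
    apply Rmult_le_compat_r; [apply Rlt_le, Rinv_0_lt_compat; lra|].
    assert (2 * j <= m) by lra. generalize (tanh_lt_1 (j * (T / 2))); nra. }
  assert (Pj : steklov_poly a b T j (2 * c / (a + b)) <= 0).
  { rewrite steklov_poly_factor by lra. assert (H := steklov_poly_lead_pos j ltac:(lra)).
    assert (0 <= a * b * shc j T * ((2 * c / (a + b) - steklov_root a b T j false)
                                    * (steklov_root a b T j true - 2 * c / (a + b)))).
    { apply Rmult_le_pos; [lra|]. apply Rmult_le_pos; lra. }
    lra. }
  assert (G := critical_gap m x j k T Hm Hx E ltac:(lra) Hjk Hs). fold c in G.
  assert (Hchar : forall w, 0 < w -> steklov_poly a b T w (2 * c / (a + b)) =
     shc w T * (a * b * (2 * c / (a + b)) ^ 2 - 2 * c * (w * coth (w * T)) + w ^ 2)).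
  { intros w Hw. unfold steklov_poly, shc, coth. destruct (Req_EM_T w 0); [lra|].
    assert (Sw := sinh_pos (w * T) ltac:(nra)). field; lra. }
  rewrite Hchar in Pj, Pk by lra.
  assert (Sk := shc_pos k T ltac:(lra) HT). assert (Sj := shc_pos j T ltac:(lra) HT).
  set (u := a * b * (2 * c / (a + b)) ^ 2) in *.
  assert (0 < u - 2 * c * (k * coth (k * T)) + k ^ 2) by nra.
  assert (u - 2 * c * (j * coth (j * T)) + j ^ 2 <= 0) by nra.
  lra.
Qed.

Lemma steklov_root_false_low m x j : 2 <= m -> 0 < x -> m * tanh (m * x) = coth x ->
  0 <= j -> 2 * j <= m -> steklov_root a b T j false <= 2 * coth x / (a + b).
Proof.
  intros Hm Hx E Hj Hjm. assert (Hc := critical_value_ge m x Hm Hx E).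
  destruct (Rle_lt_or_eq_dec 0 j Hj) as [Hj' | <-].
  - apply Rle_trans with (1 := steklov_root_false_le j ltac:(lra)).
    apply Rmult_le_compat_r; [apply Rlt_le, Rinv_0_lt_compat; lra|].
    generalize (tanh_lt_1 (j * (T / 2))); nra.
  - rewrite steklov_root_false_0. apply Rdiv_le_0_compat; lra.
Qed.

End Roots.

Lemma steklov_root_equal_radii a T w sg : 0 < a -> 0 < T -> 0 < w ->
  steklov_root a a T w sg = w * (if sg then coth (w * (T / 2)) else tanh (w * (T / 2))) / a.
Proof.
  intros Ha HT Hw. unfold steklov_root, shc. destruct (Req_EM_T w 0); [lra|].
  replace ((a - a) ^ 2 * cosh (w * T) ^ 2 + 4 * (a * a)) with ((2 * a) ^ 2) by ring.
  rewrite sqrt_pow2 by lra.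
  set (y := w * (T / 2)). assert (Hy : 0 < y) by (unfold y; apply Rmult_lt_0_compat; lra).
  replace (w * T) with (y + y) by (unfold y; field).
  rewrite sinh_add, cosh_add. assert (Cy := cosh_pos y). assert (Sy := sinh_pos y Hy).
  assert (E := cosh2_sinh2 y). unfold coth, tanh.
  replace (sinh y * cosh y + cosh y * sinh y) with (2 * (sinh y * cosh y)) by ring.
  destruct sg.
  - replace (cosh y * cosh y + sinh y * sinh y) with (2 * (cosh y * cosh y) - 1) by lra.
    field; repeat split; lra.
  - rewrite E at 1. field; repeat split; lra.
Qed.

(** * Smooth functions and the reduction to the flat cylinder *)

Lemma Derive_n_S (f : R -> R) k x : Derive_n (Derive f) k x = Derive_n f (S k) x.
Proof. rewrite <- (Nat.add_1_r k). exact (Derive_n_comp f k 1 x). Qed.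

Lemma smooth1_ex_derive f : smooth1 f -> forall x, ex_derive f x.
Proof. intros H x; exact (H 1%nat x). Qed.

Lemma smooth1_Derive f : smooth1 f -> smooth1 (Derive f).
Proof.
  intros H [|k] x; [exact I|]. simpl.
  apply (ex_derive_ext (Derive_n f (S k))); [intros y; symmetry; apply Derive_n_S | exact (H (S (S k)) x)].
Qed.

Lemma ex_derive_n_step (f : R -> R) k x :
  (forall x, ex_derive f x) -> ex_derive_n (Derive f) k x -> ex_derive_n f (S k) x.
Proof.
  intros H0 H1. destruct k as [|k]; [exact (H0 x)|].
  apply (ex_derive_ext (Derive_n (Derive f) k)); [intros y; apply Derive_n_S | exact H1].
Qed.

(** Every derivative of f is a combination of f and g. *)
Lemma smooth1_ode (f g : R -> R) (c : R) :
  (forall x, is_derive f x (g x)) -> (forall x, is_derive g x (c * f x)) -> smooth1 f.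
Proof.
  intros Hf Hg.
  assert (H : forall k, exists p q, forall x, Derive_n f k x = p * f x + q * g x).
  { induction k as [|k [p [q IH]]].
    - exists 1, 0; intros x; simpl; ring.
    - exists (q * c), p; intros x; simpl. rewrite (Derive_ext _ _ _ IH).
      apply is_derive_unique.
      replace (q * c * f x + p * g x) with (plus (p * g x) (q * (c * f x))) by (unfold plus; simpl; ring).
      apply (is_derive_plus (fun x => p * f x) (fun x => q * g x)); apply is_derive_scal; auto. }
  intros [|k] x; [exact I|]. destruct (H k) as [p [q E]]. simpl.
  apply (ex_derive_ext (fun x => p * f x + q * g x)); [intros; now rewrite E|].
  apply (ex_derive_plus (fun x => p * f x) (fun x => q * g x)); apply ex_derive_scal; eexists; eauto.
Qed.

Lemma smooth1_plus f g : smooth1 f -> smooth1 g -> smooth1 (fun x => f x + g x).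
Proof. intros Hf Hg k x; apply ex_derive_n_plus; apply filter_forall; intros y j _; auto. Qed.

Lemma smooth1_mult f g : smooth1 f -> smooth1 g -> smooth1 (fun x => f x * g x).
Proof.
  intros Hf Hg k. cut (forall j, (j <= k)%nat -> forall x, ex_derive_n (fun x => f x * g x) j x); [auto|].
  revert f g Hf Hg; induction k as [|k IH]; intros f g Hf Hg j Hj x.
  { replace j with 0%nat by lia; exact I. }
  destruct j as [|j]; [exact I|].
  apply ex_derive_n_step.
  - intros y; apply (ex_derive_mult f g); now apply smooth1_ex_derive.
  - apply (ex_derive_n_ext (fun x => Derive f x * g x + f x * Derive g x)).
    + intros y; rewrite Derive_mult by now apply smooth1_ex_derive. ring.
    + apply ex_derive_n_plus; apply filter_forall; intros y i Hi; apply IH;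
        auto using smooth1_Derive; lia.
Qed.

Lemma smooth1_const c : smooth1 (fun _ => c).
Proof.
  apply (smooth1_ode _ (fun _ => 0) 0); intros x; [|rewrite Rmult_0_l]; apply (is_derive_const (_ : R)).
Qed.

Lemma smooth1_scal c f : smooth1 f -> smooth1 (fun x => c * f x).
Proof. apply (smooth1_mult (fun _ => c)), smooth1_const. Qed.

(** The k-th derivative of sqrt q has the form P sqrt q / q^k with P smooth. *)
Lemma smooth1_sqrt q : smooth1 q -> (forall x, 0 < q x) -> smooth1 (fun x => sqrt (q x)).
Proof.
  intros Hq Hp.
  assert (Hsp : forall x, 0 < sqrt (q x)) by (intros; now apply sqrt_lt_R0).
  assert (HD : forall n P x, smooth1 P ->
    is_derive (fun x => P x * sqrt (q x) / q x ^ n) x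
      ((Derive P x * q x + (1 / 2 - INR n) * (P x * Derive q x)) * sqrt (q x) / q x ^ (S n))).
  { intros n P x HP. assert (Hx := Hp x). assert (Hn : 0 < q x ^ n) by now apply pow_lt.
    assert (EP := smooth1_ex_derive P HP x). assert (Eq := smooth1_ex_derive q Hq x).
    auto_derive; [repeat split; auto; lra|].
    (* Moving sqrt q to the numerator makes both sides linear in sqrt q, with coefficients
       rational in q. *)
    assert (E : / (2 * sqrt (q x)) = sqrt (q x) / (2 * q x)).
    { rewrite <- (sqrt_sqrt (q x)) at 3 by lra. specialize (Hsp x). field. lra. }
    rewrite !Rmult_1_l. 
    change (Derive (fun x0 : R => P x0) x) with (Derive P x).
    change (Derive (fun x0 : R => q x0) x) with (Derive q x).
    destruct n as [|n].
    - simpl. rewrite E. field. lra.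
    - rewrite Nat.pred_succ in *. simpl pow. simpl in Hn. assert (Hn' : 0 < q x ^ n) by now apply pow_lt.
      rewrite E. field. lra. }
  assert (H : forall k, exists P, smooth1 P /\ forall x, Derive_n (fun x => sqrt (q x)) k x = P x * sqrt (q x) / q x ^ k).
  { induction k as [|k [P [HP IH]]].
    - exists (fun _ => 1); split; [apply smooth1_const|]. intros x; simpl; field.
    - exists (fun x => Derive P x * q x + (1 / 2 - INR k) * (P x * Derive q x)); split.
      + apply smooth1_plus; [apply smooth1_mult; auto using smooth1_Derive|].
        apply (smooth1_mult (fun _ => 1 / 2 - INR k)); [apply smooth1_const|].
        apply smooth1_mult; auto using smooth1_Derive.
      + intros x; simpl Derive_n. rewrite (Derive_ext _ _ _ IH). now apply is_derive_unique, HD. }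
  intros [|k] x; [exact I|]. destruct (H k) as [P [HP E]]. simpl.
  apply (ex_derive_ext (fun x => P x * sqrt (q x) / q x ^ k)); [intros; now rewrite E|].
  eexists; now apply HD.
Qed.

Lemma continuity_2d_prod P Q : smooth1 P -> smooth1 Q ->
  forall t th, continuity_2d_pt (fun t th => P t * Q th) t th.
Proof.
  intros HP HQ t th. apply continuity_2d_pt_mult.
  - apply (continuity_1d_2d_pt_comp P (fun u _ => u)); [|apply continuity_2d_pt_id1].
    apply continuity_pt_filterlim, (ex_derive_continuous P), smooth1_ex_derive, HP.
  - apply (continuity_1d_2d_pt_comp Q (fun _ v => v)); [|apply continuity_2d_pt_id2].
    apply continuity_pt_filterlim, (ex_derive_continuous Q), smooth1_ex_derive, HQ.
Qed.

Lemma d_t_prod P Q : smooth1 P -> d_t (fun t th => P t * Q th) = fun t th => Derive P t * Q th.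
Proof.
  intros HP. do 2 (apply functional_extensionality; intros). unfold d_t. 
  apply is_derive_unique. assert (E := smooth1_ex_derive P HP x). auto_derive; [easy|].
  change (Derive (fun x : R => P x) x) with (Derive P x). ring.
Qed.

Lemma d_th_prod P Q : smooth1 Q -> d_th (fun t th => P t * Q th) = fun t th => P t * Derive Q th.
Proof.
  intros HQ. do 2 (apply functional_extensionality; intros). unfold d_th. 
  apply is_derive_unique. assert (E := smooth1_ex_derive Q HQ x0). auto_derive; [easy|].
  change (Derive (fun x : R => Q x) x0) with (Derive Q x0). ring.
Qed.

Lemma smooth2_prod P Q : smooth1 P -> smooth1 Q -> smooth2 (fun t th => P t * Q th).
Proof.
  intros HP HQ k; revert P Q HP HQ; induction k as [|k IH]; intros P Q HP HQ.
  - exact (continuity_2d_prod P Q HP HQ).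
  - simpl. rewrite d_t_prod, d_th_prod by easy.
    split; [intros t th; split | split; apply IH; auto using smooth1_Derive].
    + assert (E := smooth1_ex_derive P HP t). auto_derive; easy.
    + assert (E := smooth1_ex_derive Q HQ th). auto_derive; easy.
Qed.

(** The Steklov problem of the flat cylinder with boundary weights a and b, to which a
    conformal metric reduces because the Dirichlet energy of a surface is conformally
    invariant. *)
Definition flat_steklov (a b T s : R) (u : bfun) : Prop :=
  smooth_bfun u /\ exists U : R -> R -> R,
    smooth2 U /\ (forall t, periodic (U t))
    /\ (forall t th, 0 < t < T -> d_t (d_t U) t th + d_th (d_th U) t th = 0)
    /\ (forall e th, U (edge T e) th = u e th)
    /\ (forall th, d_t U 0 th = - (s * a * u false th))
    /\ (forall th, d_t U T th = s * b * u true th).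

Section Conformal.
Variables (g : metric) (T : R) (f : R -> R).
Hypothesis HT : 0 < T.
Hypothesis Hf : forall t, 0 <= t <= T -> 0 < f t.
Hypothesis Hg : forall t th, 0 <= t <= T ->
  gE g t th = f t ^ 2 /\ gF g t th = 0 /\ gG g t th = f t ^ 2.

Lemma conformal_gdet t th : 0 <= t <= T -> gdet g t th = (f t ^ 2) ^ 2.
Proof. intros Ht; unfold gdet; destruct (Hg t th Ht) as (-> & -> & ->); ring. Qed.

Lemma conformal_grad t th U : 0 <= t <= T ->
  grad_t g U t th = d_t U t th / f t ^ 2 /\ grad_th g U t th = d_th U t th / f t ^ 2.
Proof.
  intros Ht; unfold grad_t, grad_th. rewrite conformal_gdet by easy.
  destruct (Hg t th Ht) as (-> & -> & ->). assert (H := Hf t Ht). split; field; lra.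
Qed.

(** In dimension 2 the factors f^2 of the area form and f^(-2) of the gradient cancel. *)
Lemma conformal_flux t th U : 0 <= t <= T ->
  sqrt (gdet g t th) * grad_t g U t th = d_t U t th
  /\ sqrt (gdet g t th) * grad_th g U t th = d_th U t th.
Proof.
  intros Ht. destruct (conformal_grad t th U Ht) as [-> ->].
  rewrite conformal_gdet, sqrt_pow2 by (auto; apply pow2_ge_0). assert (H := Hf t Ht).
  split; field; lra.
Qed.

Lemma conformal_laplace U t th : 0 < t < T ->
  laplace_beltrami g U t th = (d_t (d_t U) t th + d_th (d_th U) t th) / f t ^ 2.
Proof.
  intros Ht. unfold laplace_beltrami.
  rewrite conformal_gdet, sqrt_pow2 by (try apply pow2_ge_0; lra).
  f_equal; f_equal.
  - unfold d_t at 1. apply Derive_ext_loc.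
    assert (Hd : 0 < Rmin t (T - t)) by (apply Rmin_glb_lt; lra).
    exists (mkposreal _ Hd); intros y Hy. apply conformal_flux.
    change (Rabs (y - t) < Rmin t (T - t)) in Hy. apply Rabs_lt_between in Hy.
    generalize (Rmin_l t (T - t)) (Rmin_r t (T - t)); lra.
  - unfold d_th at 1. apply Derive_ext; intros y. apply conformal_flux; lra.
Qed.

Lemma conformal_normal U e th :
  normal_derivative g T U e th = (if e then 1 else -1) * d_t U (edge T e) th / f (edge T e).
Proof.
  assert (Ht : 0 <= edge T e <= T) by (destruct e; simpl; lra).
  unfold normal_derivative. destruct (conformal_grad _ th U Ht) as [-> _].
  rewrite conformal_gdet by easy. destruct (Hg _ th Ht) as (_ & _ & ->).
  assert (H := Hf _ Ht). set (r := f (edge T e)) in *.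
  replace (r ^ 2 / (r ^ 2) ^ 2) with ((/ r) ^ 2) by (field; lra).
  rewrite sqrt_pow2 by (apply Rlt_le, Rinv_0_lt_compat; easy). field; lra.
Qed.

Lemma conformal_eigenspace s u :
  steklov_eigenspace g T s u <-> flat_steklov (f 0) (f T) T s u.
Proof.
  assert (H0 := Hf 0 ltac:(lra)). assert (H1 := Hf T ltac:(lra)).
  unfold steklov_eigenspace, flat_steklov, DtN, harmonic_extension.
  split; intros [Hu [U HU]]; (split; [exact Hu|]; exists U).
  - destruct HU as [(Hs & Hp & Hh & Hb) Hn]. repeat split; auto.
    + intros t th Ht. specialize (Hh t th Ht). rewrite conformal_laplace in Hh by easy.
      assert (Hft := Hf t ltac:(lra)).
      apply (Rmult_eq_reg_r (/ f t ^ 2)); [rewrite Rmult_0_l; exact Hh|].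
      apply Rinv_neq_0_compat, pow_nonzero; lra.
    + intros th. specialize (Hn false th). rewrite conformal_normal in Hn. simpl in Hn.
      replace (s * f 0 * u false th) with (s * u false th * f 0) by ring.
      rewrite Hn; field; lra.
    + intros th. specialize (Hn true th). rewrite conformal_normal in Hn. simpl in Hn.
      replace (s * f T * u true th) with (s * u true th * f T) by ring.
      rewrite Hn; field; lra.
  - destruct HU as (Hs & Hp & Hh & Hb & Hn0 & Hn1). repeat split; auto.
    + intros t th Ht. rewrite conformal_laplace, Hh by easy. unfold Rdiv; ring.
    + intros [|] th; rewrite conformal_normal; simpl; [rewrite Hn1 | rewrite Hn0]; field; lra.
Qed.

Lemma conformal_boundary_length : boundary_length g T = 2 * PI * (f 0 + f T).
Proof.
  unfold boundary_length.
  rewrite (RInt_ext _ (fun _ => f 0)), (RInt_ext (fun th => sqrt (gG g T th)) (fun _ => f T)).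
  - rewrite !RInt_const. unfold scal; simpl; unfold mult; simpl. ring.
  - intros x _. destruct (Hg T x ltac:(lra)) as (_ & _ & ->). apply sqrt_pow2, Rlt_le, Hf; lra.
  - intros x _. destruct (Hg 0 x ltac:(lra)) as (_ & _ & ->). apply sqrt_pow2, Rlt_le, Hf; lra.
Qed.
End Conformal.

(** * Fourier series on the circle *)

Lemma smooth1_continuous f x : smooth1 f -> continuous f x.
Proof. intros H; apply (ex_derive_continuous f), smooth1_ex_derive, H. Qed.

Lemma RInt_value (f : R -> R) (a b l : R) : is_RInt f a b l -> RInt f a b = l.
Proof. apply (is_RInt_unique (V := R_CompleteNormedModule)). Qed.

Lemma is_RInt_ext_eq (f h : R -> R) (a b l : R) :
  is_RInt f a b l -> (forall x, f x = h x) -> is_RInt h a b l.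
Proof. intros H E; apply (is_RInt_ext f); [intros; apply E | exact H]. Qed.

(** The trigonometric system is listed as 1, sin th, cos th, sin 2th, cos 2th, and so
    on: index 2k is the cosine and index 2k - 1 the sine of frequency k. *)
Definition freq (r : nat) : R := INR (Nat.div2 (S r)).

Definition trig (r : nat) (x : R) : R :=
  if Nat.even r then cos (freq r * x) else sin (freq r * x).

Definition dtrig (r : nat) (x : R) : R :=
  if Nat.even r then - freq r * sin (freq r * x) else freq r * cos (freq r * x).

Lemma trig_derive r x : is_derive (trig r) x (dtrig r x).
Proof. unfold trig, dtrig; destruct (Nat.even r); auto_derive; auto; ring. Qed.

Lemma dtrig_derive r x : is_derive (dtrig r) x (- freq r ^ 2 * trig r x).
Proof. unfold trig, dtrig; destruct (Nat.even r); auto_derive; auto; ring. Qed.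

Lemma smooth1_trig r : smooth1 (trig r).
Proof. exact (smooth1_ode _ _ _ (trig_derive r) (dtrig_derive r)). Qed.

Lemma trig_continuous r x : continuous (trig r) x.
Proof. apply smooth1_continuous, smooth1_trig. Qed.

Lemma trig_periodic r : periodic (trig r).
Proof.
  intros x; unfold trig, freq. set (k := Nat.div2 (S r)).
  replace (INR k * (x + 2 * PI)) with (INR k * x + 2 * INR k * PI) by ring.
  now rewrite cos_period, sin_period.
Qed.

Lemma dtrig_periodic r : periodic (dtrig r).
Proof.
  intros x; unfold dtrig, freq. set (k := Nat.div2 (S r)).
  replace (INR k * (x + 2 * PI)) with (INR k * x + 2 * INR k * PI) by ring.
  now rewrite cos_period, sin_period.
Qed.

Lemma freq_even k : freq (2 * k) = INR k.
Proof. unfold freq. now rewrite Nat.div2_succ_double. Qed.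

Lemma freq_odd k : freq (2 * k + 1) = INR (S k).
Proof. unfold freq. f_equal. replace (S (2 * k + 1)) with (2 * (S k))%nat by lia. apply Nat.div2_double. Qed.

Lemma freq_nonneg r : 0 <= freq r.
Proof. apply pos_INR. Qed.

Definition fourier (v : R -> R) (r : nat) : R := RInt (fun x => v x * trig r x) 0 (2 * PI).

Lemma ex_RInt_mult_trig v r : (forall x, continuous v x) ->
  ex_RInt (fun x => v x * trig r x) 0 (2 * PI).
Proof.
  intros Hv. apply (ex_RInt_continuous (V := R_CompleteNormedModule)); intros x _.
  apply (continuous_mult v (trig r)); [apply Hv | apply trig_continuous].
Qed.

Lemma fourier_is_RInt v r : (forall x, continuous v x) ->
  is_RInt (fun x => v x * trig r x) 0 (2 * PI) (fourier v r).
Proof. intros Hv; apply (RInt_correct (fun x => v x * trig r x)), ex_RInt_mult_trig, Hv. Qed.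

(** Integration by parts, twice. *)
Lemma fourier_second_derivative v v1 v2 r :
  (forall x, is_derive v x (v1 x)) -> (forall x, is_derive v1 x (v2 x)) ->
  (forall x, continuous v2 x) -> periodic v -> periodic v1 ->
  fourier v2 r = - freq r ^ 2 * fourier v r.
Proof.
  intros H1 H2 Hc Hp Hp1.
  assert (Cv : forall x, continuous v x)
    by (intros x; apply (ex_derive_continuous v); eexists; apply H1).
  assert (I : is_RInt (fun x => v2 x * trig r x + freq r ^ 2 * (v x * trig r x)) 0 (2 * PI) 0).
  { replace 0 with (minus (v1 (2 * PI) * trig r (2 * PI) - v (2 * PI) * dtrig r (2 * PI))
                      (v1 0 * trig r 0 - v 0 * dtrig r 0)) at 2.
    - apply (is_RInt_derive (fun x => v1 x * trig r x - v x * dtrig r x)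
               (fun x => v2 x * trig r x + freq r ^ 2 * (v x * trig r x))); intros x _.
      + assert (D1 := H1 x). assert (D2 := H2 x).
        assert (D3 := trig_derive r x). assert (D4 := dtrig_derive r x).
        auto_derive; [repeat split; eexists; eauto|].
        change (fun x0 : R => v x0) with v. change (fun x0 : R => v1 x0) with v1.
        change (fun x0 : R => trig r x0) with (trig r). change (fun x0 : R => dtrig r x0) with (dtrig r).
        rewrite (is_derive_unique _ _ _ D1), (is_derive_unique _ _ _ D2),
          (is_derive_unique _ _ _ D3), (is_derive_unique _ _ _ D4). ring.
      + apply (continuous_plus (fun x => v2 x * trig r x)).
        * apply (continuous_mult v2 (trig r)); [apply Hc | apply trig_continuous].
        * apply (continuous_scal_r (freq r ^ 2) (fun x => v x * trig r x)).
          apply (continuous_mult v (trig r)); [apply Cv | apply trig_continuous].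
    - replace (2 * PI) with (0 + 2 * PI) by ring.
      rewrite Hp, Hp1, trig_periodic, dtrig_periodic. unfold minus, plus, opp; simpl; ring. }
  assert (I' : is_RInt (fun x => v2 x * trig r x + freq r ^ 2 * (v x * trig r x)) 0 (2 * PI)
                 (fourier v2 r + freq r ^ 2 * fourier v r)).
  { apply (is_RInt_plus (fun x => v2 x * trig r x) (fun x => freq r ^ 2 * (v x * trig r x))).
    - now apply fourier_is_RInt.
    - apply (is_RInt_scal (fun x => v x * trig r x)). now apply fourier_is_RInt. }
  apply RInt_value in I. apply RInt_value in I'. rewrite I in I'. lra.
Qed.

(** Two members of different frequency are eigenfunctions of the second derivative with
    different eigenvalues; the sine and cosine of one frequency have the primitive
    sin^2 / 2w of their product. *)
Lemma trig_orthogonal r r' : r <> r' -> fourier (trig r') r = 0.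
Proof.
  intros Hr. destruct (Req_EM_T (freq r) (freq r')) as [E | E].
  - assert (G : forall k, fourier (trig (2 * k + 1)) (2 * (k + 1)) = 0 /\
                          fourier (trig (2 * (k + 1))) (2 * k + 1) = 0).
    { intros k.
      assert (I : is_RInt (fun x => sin (INR (S k) * x) * cos (INR (S k) * x)) 0 (2 * PI) 0).
      { assert (Hk : 0 < INR (S k)) by (apply lt_0_INR; lia). set (w := INR (S k)) in *.
        replace 0 with (minus (sin (w * (2 * PI)) ^ 2 / (2 * w)) (sin (w * 0) ^ 2 / (2 * w))) at 2.
        - apply (is_RInt_derive (fun x => sin (w * x) ^ 2 / (2 * w)) (fun x => sin (w * x) * cos (w * x)));
            intros x _.
          + auto_derive; [auto|]. field; lra.
          + apply (ex_derive_continuous (fun x => sin (w * x) * cos (w * x))). auto_derive; auto.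
        - replace (w * (2 * PI)) with (0 + 2 * w * PI) by ring. unfold w at 1; rewrite sin_period.
          rewrite Rmult_0_r. unfold minus, plus, opp; simpl; ring. }
      assert (O : forall k, Nat.even (2 * k + 1) = false) by (intros; apply Nat.even_odd).
      assert (V : forall k, Nat.even (2 * k) = true) by (intros; apply Nat.even_even).
      split; apply RInt_value; refine (is_RInt_ext_eq _ _ _ _ _ I _); intros x;
        unfold trig; rewrite O, V, freq_odd, freq_even; rewrite Nat.add_1_r; ring. }
    (* Distinct indices of equal frequency are consecutive, the odd one first; k is the
       smaller of the two halves. *)
    assert (P : exists k, (r = 2 * k + 1 /\ r' = 2 * (k + 1) \/ r' = 2 * k + 1 /\ r = 2 * (k + 1))%nat).
    { apply INR_eq in E. rewrite !Nat.div2_div in E.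
      exists (r / 2 + r' / 2 - Nat.max (r / 2) (r' / 2))%nat.
      assert (Hm := Nat.div_mod_eq). generalize (Hm (S r) 2%nat) (Hm (S r') 2%nat) (Hm r 2%nat) (Hm r' 2%nat)
       (Nat.mod_upper_bound (S r) 2 ltac:(lia)) (Nat.mod_upper_bound (S r') 2 ltac:(lia))
       (Nat.mod_upper_bound (r) 2 ltac:(lia)) (Nat.mod_upper_bound (r') 2 ltac:(lia)). lia. }
    destruct P as [k [[-> ->] | [-> ->]]]; [exact (proj2 (G k)) | exact (proj1 (G k))].
  - assert (G : fourier (fun x => - freq r' ^ 2 * trig r' x) r = - freq r ^ 2 * fourier (trig r') r).
    { apply (fourier_second_derivative (trig r') (dtrig r')).
      - apply trig_derive.
      - apply dtrig_derive.
      - intros x; apply (continuous_scal_r (- freq r' ^ 2) (trig r')), trig_continuous.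
      - apply trig_periodic.
      - apply dtrig_periodic. }
    assert (G' : fourier (fun x => - freq r' ^ 2 * trig r' x) r = - freq r' ^ 2 * fourier (trig r') r).
    { unfold fourier. rewrite (RInt_ext _ (fun x => scal (- freq r' ^ 2) (trig r' x * trig r x))).
      - apply (RInt_scal (fun x => trig r' x * trig r x)), ex_RInt_mult_trig, trig_continuous.
      - intros x _. unfold scal; simpl; unfold mult; simpl; ring. }
    rewrite G' in G.
    assert (N : freq r ^ 2 <> freq r' ^ 2).
    { intros A. apply E. assert (P1 := freq_nonneg r). assert (P2 := freq_nonneg r'). nra. }
    assert (Z : (freq r ^ 2 - freq r' ^ 2) * fourier (trig r') r = 0) by lra.
    apply Rmult_integral in Z as [Z | Z]; [exfalso; lra | easy].
Qed.

Lemma trig_norm_pos r : 0 < fourier (trig r) r.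
Proof.
  assert (Pi := PI_RGT_0). unfold fourier.
  destruct (Nat.eq_dec r 0) as [-> | Hr].
  - rewrite (RInt_ext _ (fun _ => 1)).
    + rewrite RInt_const. unfold scal; simpl; unfold mult; simpl. lra.
    + intros x _. unfold trig, freq; simpl. rewrite Rmult_0_l, cos_0; ring.
  - assert (Hw : 0 < freq r).
    { apply lt_0_INR. rewrite Nat.div2_div. apply Nat.div_str_pos. lia. }
    set (e := if Nat.even r then 1 else -1).
    assert (I : is_RInt (fun x => trig r x * trig r x) 0 (2 * PI)
      (minus ((2 * PI + e * (sin (freq r * (2 * PI)) * cos (freq r * (2 * PI)) / freq r)) / 2)
             ((0 + e * (sin (freq r * 0) * cos (freq r * 0) / freq r)) / 2))).
    { apply (is_RInt_derive (fun x => (x + e * (sin (freq r * x) * cos (freq r * x) / freq r)) / 2));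
        intros x _.
      - unfold trig. auto_derive; [auto|]. generalize (sin2_cos2 (freq r * x)); unfold Rsqr, e; intros S.
        destruct (Nat.even r); field_simplify; try lra;
          [replace (sin (freq r * x) ^ 2) with (1 - cos (freq r * x) ^ 2) by lra
          |replace (cos (freq r * x) ^ 2) with (1 - sin (freq r * x) ^ 2) by lra]; field; lra.
      - apply (continuous_mult (trig r) (trig r)); apply trig_continuous. }
    apply RInt_value in I. rewrite I.
    replace (freq r * (2 * PI)) with (0 + 2 * freq r * PI) by ring.
    unfold freq at 1 3; rewrite sin_period. rewrite Rmult_0_r, sin_0.
    unfold minus, plus, opp; simpl. lra.
Qed.

Lemma is_RInt_periodic_shift f c l : (forall x, continuous f x) -> periodic f ->
  is_RInt f 0 (2 * PI) l -> is_RInt f c (c + 2 * PI) l.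
Proof.
  intros Hc Hp H.
  assert (E : forall a b, ex_RInt f a b)
    by (intros; apply (ex_RInt_continuous (V := R_CompleteNormedModule)); intros; apply Hc).
  apply RInt_value in H.
  assert (Q : RInt f (2 * PI) (c + 2 * PI) = RInt f 0 c).
  { assert (A := RInt_comp_lin f 1 (2 * PI) 0 c (E _ _)).
    rewrite !Rmult_1_l, Rplus_0_l in A. rewrite <- A.
    apply RInt_ext; intros x _. unfold scal; simpl; unfold mult; simpl.
    rewrite !Rmult_1_l. apply Hp. }
  replace l with (RInt f c (c + 2 * PI)); [apply (RInt_correct f), E|].
  assert (C1 := RInt_Chasles f c 0 (c + 2 * PI) (E _ _) (E _ _)).
  assert (C2 := RInt_Chasles f 0 (2 * PI) (c + 2 * PI) (E _ _) (E _ _)).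
  assert (C3 := opp_RInt_swap f 0 c (E _ _)).
  unfold plus, opp in *; simpl in *. rewrite H, Q in C2. rewrite <- C1, <- C2, <- C3. ring.
Qed.

(** Allowing all integer frequencies and all phases makes this condition stable under
    multiplication of v by cos (x - x0). *)
Definition annihilates (a b : R) (v : R -> R) : Prop :=
  forall (z : Z) (phi : R), is_RInt (fun x => v x * cos (IZR z * x + phi)) a b 0.

Lemma annihilates_mult_cos a b v c x0 : annihilates a b v ->
  annihilates a b (fun x => v x * (c + cos (x - x0))).
Proof.
  intros H z phi.
  assert (I : is_RInt (fun x => plus (c * (v x * cos (IZR z * x + phi)))
     (plus (/ 2 * (v x * cos (IZR (z + 1) * x + (phi - x0))))
           (/ 2 * (v x * cos (IZR (z - 1) * x + (phi + x0)))))) a b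
     (plus (c * 0) (plus (/ 2 * 0) (/ 2 * 0)))).
  { apply @is_RInt_plus; [|apply @is_RInt_plus];
      (apply @is_RInt_scal with (If := 0)); apply H. }
  replace (plus (c * 0) (plus (/ 2 * 0) (/ 2 * 0))) with 0 in I by (unfold plus; simpl; ring).
  refine (is_RInt_ext_eq _ _ _ _ _ I _). intros x. unfold plus; simpl.
  rewrite plus_IZR, minus_IZR.
  replace ((IZR z + 1) * x + (phi - x0)) with ((IZR z * x + phi) + (x - x0)) by ring.
  replace ((IZR z - 1) * x + (phi + x0)) with ((IZR z * x + phi) - (x - x0)) by ring.
  generalize (IZR z * x + phi) (x - x0); intros u w.
  rewrite cos_plus, cos_minus. field.
Qed.

Lemma annihilates_mult_cos_pow a b v c x0 n : annihilates a b v ->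
  annihilates a b (fun x => v x * (c + cos (x - x0)) ^ n).
Proof.
  intros H; induction n as [|n IH].
  - intros z phi. refine (is_RInt_ext_eq _ _ _ _ _ (H z phi) _); intros; simpl; ring.
  - intros z phi. refine (is_RInt_ext_eq _ _ _ _ _ (annihilates_mult_cos _ _ _ c x0 IH z phi) _).
    intros; simpl; ring.
Qed.

(** If v(x0) > 0, test v against the powers of J = 1 - cos d + cos (x - x0), where d is
    such that v >= v(x0)/2 at distance at most d from x0.  At larger distances |J| <= 1,
    and at distance at most d/2 the powers of J grow exponentially, while all the
    integrals of v J^n vanish. *)
Lemma annihilates_nonpos v x0 : (forall x, continuous v x) ->
  annihilates (x0 - PI) (x0 + PI) v -> v x0 <= 0.
Proof.
  intros Hc HA. assert (Pi := PI_RGT_0). apply Rnot_lt_le; intros Hv.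
  (* M bounds |v| on the period centred at x0. *)
  destruct (continuity_ab_maj (fun x => Rabs (v x)) (x0 - PI) (x0 + PI) ltac:(lra)) as [xM [HM _]].
  { intros x _. apply continuity_pt_filterlim, (continuous_comp v Rabs); [apply Hc | apply continuous_Rabs]. }
  set (M := Rabs (v xM)) in *. assert (M0 : 0 <= M) by apply Rabs_pos.
  assert (Hd : exists d, 0 < d < PI /\ forall x, Rabs (x - x0) <= d -> v x0 / 2 <= v x).
  { assert (Hp : 0 < v x0 / 2) by lra.
    destruct (proj1 (filterlim_locally v (v x0)) (Hc x0) (mkposreal _ Hp)) as [d Hd].
    assert (D := cond_pos d).
    assert (Dm : 0 < Rmin (d / 2) (PI / 2)) by (apply Rmin_glb_lt; lra).
    exists (Rmin (d / 2) (PI / 2)). generalize (Rmin_l (d / 2) (PI / 2)) (Rmin_r (d / 2) (PI / 2)); intros m1 m2.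
    split; [lra|]. intros x Hx.
    assert (B : Rabs (v x - v x0) < v x0 / 2) by (apply Hd; change (Rabs (x - x0) < d); lra).
    apply Rabs_lt_between in B. lra. }
  destruct Hd as [d [Hd Hnear]].
  set (J := fun x => - cos d + 1 + cos (x - x0)).
  assert (HI : forall n, is_RInt (fun x => v x * J x ^ n) (x0 - PI) (x0 + PI) 0).
  { intros n. refine (is_RInt_ext_eq _ _ _ _ _ (annihilates_mult_cos_pow _ _ _ (- cos d + 1) x0 n HA 0%Z 0) _).
    intros x. unfold J. rewrite Rmult_0_l, Rplus_0_l, cos_0; ring. }
  set (rho := 1 + (cos (d / 2) - cos d)).
  assert (Hrho : 0 < cos (d / 2) - cos d).
  { assert (cos d < cos (d / 2)) by (apply cos_decreasing_1; lra). lra. }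
  assert (Jeven : forall x, J x = - cos d + 1 + cos (Rabs (x - x0))).
  { intros x; unfold J. f_equal. unfold Rabs; destruct (Rcase_abs (x - x0)); [now rewrite cos_neg | easy]. }
  assert (Jin : forall x, Rabs (x - x0) <= d -> 1 <= J x).
  { intros x Hx. rewrite Jeven. assert (cos d <= cos (Rabs (x - x0))); [|lra].
    apply cos_decr_1; generalize (Rabs_pos (x - x0)); lra. }
  assert (Jmid : forall x, Rabs (x - x0) <= d / 2 -> rho <= J x).
  { intros x Hx. rewrite Jeven. unfold rho.
    assert (cos (d / 2) <= cos (Rabs (x - x0))); [|lra].
    apply cos_decr_1; generalize (Rabs_pos (x - x0)); lra. }
  assert (Jout : forall x, d < Rabs (x - x0) <= PI -> Rabs (J x) <= 1).
  { intros x Hx. rewrite Jeven. apply Rabs_le.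
    assert (cos (Rabs (x - x0)) <= cos d) by (apply cos_decr_1; lra).
    generalize (COS_bound (Rabs (x - x0))) (COS_bound d); lra. }
  assert (Cont : forall n x, continuous (fun x => v x * J x ^ n) x).
  { intros n x. apply (continuous_mult v (fun x => J x ^ n)); [apply Hc|].
    apply (ex_derive_continuous (fun x => J x ^ n)). unfold J. auto_derive; auto. }
  assert (Ex : forall n a b, ex_RInt (fun x => v x * J x ^ n) a b)
    by (intros; apply (ex_RInt_continuous (V := R_CompleteNormedModule)); intros; apply Cont).
  assert (Outer : forall n a b, x0 - PI <= a <= b -> b <= x0 + PI ->
    - M * (b - a) <= RInt (fun x => v x * J x ^ n) a b).
  { intros n a b Ha Hb.
    replace (- M * (b - a)) with (RInt (fun _ => - M) a b)
      by (rewrite RInt_const; unfold scal; simpl; unfold mult; simpl; ring).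
    apply RInt_le; [lra | apply ex_RInt_const | apply Ex |]. intros x Hx.
    assert (Hx' : Rabs (x - x0) <= PI) by (apply Rabs_le; lra).
    destruct (Rle_or_lt (Rabs (x - x0)) d) as [Hxd | Hxd].
    - apply Rle_trans with 0; [lra|]. apply Rmult_le_pos.
      + specialize (Hnear x Hxd); lra.
      + apply pow_le. specialize (Jin x Hxd); lra.
    - assert (B : Rabs (v x * J x ^ n) <= M).
      { rewrite Rabs_mult, <- RPow_abs. rewrite <- (Rmult_1_r M).
        apply Rmult_le_compat; [apply Rabs_pos | apply pow_le, Rabs_pos | apply HM; lra |].
        rewrite <- (pow1 n). apply pow_incr. split; [apply Rabs_pos | apply Jout; lra]. }
      apply Rabs_le_between in B. lra. }
  assert (Inner : forall n, v x0 / 2 * rho ^ n * d <= RInt (fun x => v x * J x ^ n) (x0 - d / 2) (x0 + d / 2)).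
  { intros n.
    replace (v x0 / 2 * rho ^ n * d) with (RInt (fun _ => v x0 / 2 * rho ^ n) (x0 - d / 2) (x0 + d / 2))
      by (rewrite RInt_const; unfold scal; simpl; unfold mult; simpl; field).
    apply RInt_le; [lra | apply ex_RInt_const | apply Ex |]. intros x Hx.
    assert (Hxd : Rabs (x - x0) <= d / 2) by (apply Rabs_le; lra).
    apply Rmult_le_compat; [lra | apply pow_le; unfold rho; lra | apply Hnear; lra |].
    apply pow_incr. split; [unfold rho; lra | now apply Jmid]. }
  assert (Bound : forall n, v x0 / 2 * rho ^ n * d <= M * (2 * PI)).
  { intros n.
    assert (C1 := RInt_Chasles (fun x => v x * J x ^ n) (x0 - PI) (x0 - d / 2) (x0 + PI) (Ex _ _ _) (Ex _ _ _)).
    assert (C2 := RInt_Chasles (fun x => v x * J x ^ n) (x0 - d / 2) (x0 + d / 2) (x0 + PI) (Ex _ _ _) (Ex _ _ _)).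
    rewrite (RInt_value _ _ _ _ (HI n)) in C1. unfold plus in C1, C2; simpl in C1, C2.
    assert (O1 := Outer n (x0 - PI) (x0 - d / 2) ltac:(lra) ltac:(lra)).
    assert (O2 := Outer n (x0 + d / 2) (x0 + PI) ltac:(lra) ltac:(lra)).
    specialize (Inner n).
    set (i1 := RInt _ (x0 - PI) (x0 - d / 2)) in *. set (i2 := RInt _ (x0 - d / 2) (x0 + d / 2)) in *.
    set (i3 := RInt _ (x0 + d / 2) (x0 + PI)) in *. set (i4 := RInt _ (x0 - d / 2) (x0 + PI)) in *.
    nra. }
  assert (Hvd : 0 < v x0 / 2 * d) by (apply Rmult_lt_0_compat; lra).
  destruct (Pow_x_infinity rho) with (b := M * (2 * PI) / (v x0 / 2 * d) + 1) as [N HN].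
  { rewrite Rabs_pos_eq; unfold rho; lra. }
  specialize (HN N (le_n N)). specialize (Bound N).
  assert (Hp : 0 < rho ^ N) by (apply pow_lt; unfold rho; lra).
  rewrite Rabs_pos_eq in HN by lra.
  assert (M * (2 * PI) / (v x0 / 2 * d) * (v x0 / 2 * d) = M * (2 * PI)) by (field; lra).
  nra.
Qed.

Lemma fourier_complete v : (forall x, continuous v x) -> periodic v ->
  (forall r, fourier v r = 0) -> forall x : R, v x = 0.
Proof.
  intros Hc Hp HF x0.
  assert (Hcos : forall k : nat, is_RInt (fun x => v x * cos (INR k * x)) 0 (2 * PI) 0).
  { intros k. assert (I := fourier_is_RInt v (2 * k) Hc). rewrite HF in I.
    refine (is_RInt_ext_eq _ _ _ _ _ I _); intros x.
    unfold trig. now rewrite Nat.even_even, freq_even. }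
  assert (Hsin : forall k : nat, is_RInt (fun x => v x * sin (INR k * x)) 0 (2 * PI) 0).
  { intros [|k].
    - assert (I : is_RInt (fun x => 0 * (v x * cos (INR 0 * x))) 0 (2 * PI) (0 * 0))
        by apply @is_RInt_scal, Hcos.
      rewrite Rmult_0_l in I. refine (is_RInt_ext_eq _ _ _ _ _ I _); intros x.
      simpl. rewrite !Rmult_0_l, sin_0. ring.
    - assert (I := fourier_is_RInt v (2 * k + 1) Hc). rewrite HF in I.
      refine (is_RInt_ext_eq _ _ _ _ _ I _); intros x.
      unfold trig. now rewrite Nat.even_odd, freq_odd. }
  assert (A : annihilates 0 (2 * PI) v).
  { intros z phi.
    assert (Hz : exists (k : nat) (e : R), (e = 1 \/ e = -1) /\ IZR z = e * INR k).
    { destruct (Z.le_gt_cases 0 z) as [Hz | Hz].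
      - exists (Z.to_nat z), 1; split; [now left|]. rewrite INR_IZR_INZ, Z2Nat.id by lia. ring.
      - exists (Z.to_nat (- z)), (-1); split; [now right|].
        rewrite INR_IZR_INZ, Z2Nat.id, opp_IZR by lia. ring. }
    destruct Hz as (k & e & He & ->).
    assert (I : is_RInt (fun x => plus (cos phi * (v x * cos (INR k * x)))
                                    (- (e * sin phi) * (v x * sin (INR k * x)))) 0 (2 * PI)
                 (plus (cos phi * 0) (- (e * sin phi) * 0))).
    { apply @is_RInt_plus; apply @is_RInt_scal with (If := 0); [apply Hcos | apply Hsin]. }
    replace (plus (cos phi * 0) (- (e * sin phi) * 0)) with 0 in I by (unfold plus; simpl; ring).
    refine (is_RInt_ext_eq _ _ _ _ _ I _). intros x. unfold plus; simpl. rewrite cos_plus.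
    destruct He as [-> | ->].
    - rewrite !Rmult_1_l. ring.
    - replace (-1 * INR k * x) with (- (INR k * x)) by ring. rewrite cos_neg, sin_neg. ring. }
  assert (A' : annihilates (x0 - PI) (x0 + PI) v).
  { intros z phi. replace (x0 + PI) with (x0 - PI + 2 * PI) by ring.
    apply is_RInt_periodic_shift; [| | apply A].
    - intros x. apply (continuous_mult v (fun x => cos (IZR z * x + phi))); [apply Hc|].
      apply (ex_derive_continuous (fun x => cos (IZR z * x + phi))). auto_derive; auto.
    - intros x. rewrite Hp. f_equal. 
      destruct (Z.le_gt_cases 0 z) as [Hz | Hz].
      + replace z with (Z.of_nat (Z.to_nat z)) by lia. rewrite <- INR_IZR_INZ.
        replace (INR (Z.to_nat z) * (x + 2 * PI) + phi)
          with (INR (Z.to_nat z) * x + phi + 2 * INR (Z.to_nat z) * PI) by ring.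
        apply cos_period.
      + replace z with (- Z.of_nat (Z.to_nat (- z)))%Z by lia. rewrite opp_IZR, <- INR_IZR_INZ.
        set (k := Z.to_nat (- z)).
        replace (- INR k * x + phi) with (- INR k * (x + 2 * PI) + phi + 2 * INR k * PI) by ring.
        now rewrite cos_period. }
  apply Rle_antisym; [now apply annihilates_nonpos|].
  apply Ropp_le_cancel. rewrite Ropp_0.
  apply (annihilates_nonpos (fun x => - v x)).
  - intros x; apply (continuous_opp v), Hc.
  - intros z phi. 
    assert (I : is_RInt (fun x => opp (v x * cos (IZR z * x + phi))) (x0 - PI) (x0 + PI) (opp 0))
      by (apply @is_RInt_opp, A').
    replace (opp 0) with 0 in I by (unfold opp; simpl; ring).
    refine (is_RInt_ext_eq _ _ _ _ _ I _). intros x. unfold opp; simpl. ring.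
Qed.

(** * Dimension counting, sorting and matching of multisets *)

Lemma sum_n_m_1_S (u : nat -> R) m : sum_n_m u 1 (S m) = sum_n_m u 1 m + u (S m) :> R.
Proof. now rewrite sum_n_Sm by lia. Qed.

Lemma sum_n_m_1_0 (u : nat -> R) : sum_n_m u 1 0 = 0 :> R.
Proof. now rewrite sum_n_m_zero by lia. Qed.

Lemma sum_n_m_linear (u v : nat -> R) c m :
  sum_n_m (fun i => u i + c * v i) 1 m = sum_n_m u 1 m + c * sum_n_m v 1 m :> R.
Proof.
  induction m as [|m IH]; [rewrite !sum_n_m_1_0 | rewrite !sum_n_m_1_S, IH]; ring.
Qed.

Lemma sum_n_m_scal (v : nat -> R) c m :
  sum_n_m (fun i => c * v i) 1 m = c * sum_n_m v 1 m :> R.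
Proof. exact (sum_n_m_mult_l (K := R_Ring) c v 1 m). Qed.

Lemma sum_n_m_eq (u v : nat -> R) m :
  (forall i, (1 <= i <= m)%nat -> u i = v i) -> sum_n_m u 1 m = sum_n_m v 1 m :> R.
Proof. intros H; apply sum_n_m_ext_loc; intros; apply H; lia. Qed.

Lemma sum_n_m_single (u : nat -> R) i m : (1 <= i <= m)%nat ->
  (forall j, (1 <= j <= m)%nat -> j <> i -> u j = 0) -> sum_n_m u 1 m = u i :> R.
Proof.
  intros Hi Hu. induction m as [|m IH]; [lia|]. rewrite sum_n_m_1_S.
  destruct (Nat.eq_dec i (S m)) as [-> | Hne].
  - rewrite (sum_n_m_eq u (fun _ => 0)) by (intros; apply Hu; lia).
    rewrite sum_n_m_const. ring.
  - rewrite IH by (try lia; intros; apply Hu; lia). rewrite (Hu (S m)) by lia. ring.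
Qed.

Lemma sum_n_m_all_0 (u : nat -> R) m :
  (forall j, (1 <= j <= m)%nat -> u j = 0) -> sum_n_m u 1 m = 0 :> R.
Proof. intros Hu. rewrite (sum_n_m_eq u (fun _ => 0)) by easy. rewrite sum_n_m_const. ring. Qed.

Lemma sum_n_m_swap (u : nat -> nat -> R) m p :
  sum_n_m (fun i => sum_n_m (fun j => u i j) 1 p) 1 m =
  sum_n_m (fun j => sum_n_m (fun i => u i j) 1 m) 1 p :> R.
Proof.
  induction m as [|m IH].
  - rewrite sum_n_m_1_0. symmetry; apply sum_n_m_all_0; intros; apply sum_n_m_1_0.
  - rewrite sum_n_m_1_S, IH. 
    rewrite (sum_n_m_eq (fun j => sum_n_m (fun i => u i j) 1 (S m))
               (fun j => sum_n_m (fun i => u i j) 1 m + 1 * u (S m) j))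
      by (intros; rewrite sum_n_m_1_S; ring).
    rewrite (sum_n_m_linear (fun j => sum_n_m (fun i => u i j) 1 m) (fun j => u (S m) j)). ring.
Qed.

(** Gaussian elimination of the last unknown. *)
Lemma homogeneous_system (m : nat) (eqs : list (nat -> R)) : (length eqs < m)%nat ->
  exists c : nat -> R, (exists i, (1 <= i <= m)%nat /\ c i <> 0) /\
    forall a, In a eqs -> sum_n_m (fun i => c i * a i) 1 m = 0 :> R.
Proof.
  revert eqs; induction m as [|m IH]; intros eqs Hl; [lia|].
  destruct (classic (exists a, In a eqs /\ a (S m) <> 0)) as [[a [Ha Hn]] | Hz].
  - apply in_split in Ha as (l1 & l2 & ->).
    rewrite length_app in Hl; simpl in Hl.
    destruct (IH (map (fun e i => e i + (- (e (S m) / a (S m))) * a i) (l1 ++ l2))) as [c [[i [Hi Hc]] Hs]].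
    { rewrite length_map, length_app; lia. }
    exists (fun i => if Nat.eq_dec i (S m) then - sum_n_m (fun i => c i * a i) 1 m / a (S m) else c i).
    assert (E : forall e, sum_n_m (fun i => (if Nat.eq_dec i (S m)
       then - sum_n_m (fun i => c i * a i) 1 m / a (S m) else c i) * e i) 1 (S m)
       = sum_n_m (fun i => c i * e i) 1 m + - sum_n_m (fun i => c i * a i) 1 m / a (S m) * e (S m)).
    { intros e. rewrite sum_n_m_1_S. f_equal.
      - apply sum_n_m_eq; intros k Hk. destruct (Nat.eq_dec k (S m)); [lia | easy].
      - destruct (Nat.eq_dec (S m) (S m)); easy. }
    split.
    + exists i; split; [lia|]. destruct (Nat.eq_dec i (S m)); [lia | easy].
    + intros e He. rewrite E.
      assert (D : e = a \/ In e (l1 ++ l2)).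
      { rewrite in_app_iff in *. simpl in He. destruct He as [|[|]]; auto. }
      destruct D as [-> | D]; [field; easy|].
      specialize (Hs _ (in_map _ _ _ D)). cbv beta in Hs.
      rewrite (sum_n_m_eq _ (fun i => c i * e i + - (e (S m) / a (S m)) * (c i * a i))) in Hs
        by (intros; ring).
      rewrite (sum_n_m_linear (fun i => c i * e i) (fun i => c i * a i)) in Hs.
      rewrite <- Hs. field; easy.
  - exists (fun i => if Nat.eq_dec i (S m) then 1 else 0). split.
    + exists (S m); split; [lia|]. destruct (Nat.eq_dec (S m) (S m)); [lra | easy].
    + intros a Ha. rewrite (sum_n_m_single _ (S m)).
      * destruct (Req_EM_T (a (S m)) 0) as [-> | Hn]; [ring|]. exfalso; apply Hz; eauto.
      * lia.
      * intros j _ Hj. destruct (Nat.eq_dec j (S m)); [easy | ring].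
Qed.

(** If m < m', the m equations that express the vanishing of the coordinates of a
    combination of the m' vectors have a nontrivial solution. *)
Lemma has_dim_le E m m' : has_dim E m -> has_dim E m' -> (m' <= m)%nat.
Proof.
  intros (e & He & _ & Hspan) (e' & He' & Hind & _).
  destruct (Nat.le_gt_cases m' m) as [|Hlt]; [easy|exfalso].
  assert (HA : exists A : nat -> nat -> R, forall i, (1 <= i <= m')%nat ->
            forall b th, e' i b th = lincomb m (A i) e b th).
  { assert (HA : forall i, exists c, (1 <= i <= m')%nat -> forall b th, e' i b th = lincomb m c e b th).
    { intros i. destruct (classic (1 <= i <= m')%nat) as [Hi | Hi].
      - destruct (Hspan _ (He' i Hi)) as [c Hc]. now exists c.
      - now exists (fun _ => 0). }
    exists (fun i => proj1_sig (constructive_indefinite_description _ (HA i))).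
    intros i. exact (proj2_sig (constructive_indefinite_description _ (HA i))). }
  destruct HA as [A HA].
  destruct (homogeneous_system m' (map (fun j i => A i j) (seq 1 m))) as [c [[i [Hi Hc]] Hs]].
  { now rewrite length_map, length_seq. }
  apply Hc, (Hind c); [|easy].
  intros b th. unfold lincomb at 1.
  rewrite (sum_n_m_eq _ (fun i => sum_n_m (fun j => c i * A i j * e j b th) 1 m)).
  - rewrite sum_n_m_swap. apply sum_n_m_all_0. intros j Hj.
    rewrite (sum_n_m_eq _ (fun i => e j b th * (c i * A i j))) by (intros; ring).
    rewrite sum_n_m_scal, (Hs (fun i => A i j)); [ring|].
    apply (in_map (fun j i => A i j)), in_seq; lia.
  - intros k Hk. rewrite HA by easy. unfold lincomb. rewrite <- sum_n_m_scal.
    apply sum_n_m_eq; intros; ring.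
Qed.

Lemma has_dim_unique E m m' : has_dim E m -> has_dim E m' -> m = m'.
Proof. intros H H'; apply Nat.le_antisymm; eauto using has_dim_le. Qed.

Lemma min_of_list {A} (v : A -> R) (l : list A) : l <> nil ->
  exists x, In x l /\ forall y, In y l -> v x <= v y.
Proof.
  induction l as [|a l IH]; [easy|]; intros _.
  destruct l as [|a' l].
  - exists a; split; [now left|]. intros y [<- | []]; lra.
  - destruct IH as [x [Hx Hm]]; [easy|].
    destruct (Rle_or_lt (v a) (v x)) as [Hax | Hax].
    + exists a; split; [now left|]. intros y [<- | Hy]; [lra | specialize (Hm y Hy); lra].
    + exists x; split; [now right|]. intros y [<- | Hy]; [lra | now apply Hm].
Qed.

(** Repeatedly taking an element of least value among those not yet taken lists all
    elements: one that was never taken would have infinitely many elements of at most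
    its own value. *)
Lemma sort_enumeration {A} (v : A -> R) :
  (forall s, exists L, forall x, v x <= s -> In x L) ->
  (forall l : list A, exists x, ~ In x l) ->
  exists p : nat -> A,
    (forall k, v (p k) <= v (p (S k))) /\ (forall i j, p i = p j -> i = j) /\ (forall x, exists k, p k = x).
Proof.
  intros Hfin Hinf.
  assert (Hnext : forall l : list A, exists x, ~ In x l /\ forall y, ~ In y l -> v x <= v y).
  { intros l. destruct (Hinf l) as [z Hz]. destruct (Hfin (v z)) as [L HL].
    destruct (min_of_list v (filter (fun x => if excluded_middle_informative (In x l) then false else true) L))
      as [x [Hx Hm]].
    - intros E. assert (I : In z nil); [|destruct I]. rewrite <- E. apply filter_In; split; [apply HL; lra|].
      destruct (excluded_middle_informative (In z l)); easy.
    - apply filter_In in Hx as [Hx1 Hx2]. exists x; split.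
      + destruct (excluded_middle_informative (In x l)); easy.
      + intros y Hy. destruct (Rle_or_lt (v y) (v z)) as [Hyz | Hyz].
        * apply Hm, filter_In; split; [now apply HL|].
          destruct (excluded_middle_informative (In y l)); easy.
        * apply Rle_trans with (v z); [|lra]. apply Hm, filter_In; split; [apply HL; lra|].
          destruct (excluded_middle_informative (In z l)); easy. }
  set (next := fun l => proj1_sig (constructive_indefinite_description _ (Hnext l))).
  assert (N1 : forall l, ~ In (next l) l)
    by (intros l; exact (proj1 (proj2_sig (constructive_indefinite_description _ (Hnext l))))).
  assert (N2 : forall l y, ~ In y l -> v (next l) <= v y)
    by (intros l; exact (proj2 (proj2_sig (constructive_indefinite_description _ (Hnext l))))).
  set (used := fix used k := match k with O => nil | S k => next (used k) :: used k end).
  set (p := fun k => next (used k)).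
  assert (U : forall k x, In x (used k) <-> exists i, (i < k)%nat /\ p i = x).
  { induction k as [|k IH]; intros x; simpl.
    - split; [easy | intros [i [Hi _]]; lia].
    - rewrite IH. split.
      + intros [<- | [i [Hi <-]]]; [exists k | exists i]; split; auto; lia.
      + intros [i [Hi <-]]. destruct (Nat.eq_dec i k) as [-> | Hik]; [now left|].
        right; exists i; split; auto; lia. }
  assert (Inj : forall i j, (i < j)%nat -> p i <> p j).
  { intros i j Hij E. apply (N1 (used j)). apply U. now exists i. }
  assert (Inj' : forall i j, p i = p j -> i = j).
  { intros i j E. destruct (Nat.lt_trichotomy i j) as [H | [H | H]]; [|easy|];
      exfalso; eapply Inj; eauto. }
  exists p; repeat split.
  - intros k. apply N2. intros I. apply (N1 (used (S k))). simpl. now right.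
  - exact Inj'.
  - intros x. destruct (Hfin (v x)) as [L HL].
    apply NNPP; intros Hno.
    assert (Hall : forall k, In (p k) L).
    { intros k. apply HL, N2. intros I; apply U in I as [i [_ Hi]]. apply Hno; eauto. }
    assert (ND : NoDup (map p (seq 0 (S (length L))))).
    { apply NoDup_map_NoDup_ForallPairs; [|apply seq_NoDup]. intros i j _ _; apply Inj'. }
    assert (C : incl (map p (seq 0 (S (length L)))) L).
    { intros y Hy. apply in_map_iff in Hy as [k [<- _]]. apply Hall. }
    apply (NoDup_incl_length ND) in C. rewrite length_map, length_seq in C. lia.
Qed.

(** If each fibre of h has at least as many elements as the corresponding fibre of f,
    a list of distinct elements can be replaced, one fibre of f at a time, by distinct
    elements with the same values. *)
Lemma transfer_distinct {A B} (f : A -> R) (h : B -> R) :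
  (forall l s, NoDup l -> (forall x, In x l -> f x = s) ->
     exists l', NoDup l' /\ length l' = length l /\ forall y, In y l' -> h y = s) ->
  forall l, NoDup l -> exists l', NoDup l' /\ length l' = length l
     /\ forall y, In y l' -> exists x, In x l /\ h y = f x.
Proof.
  intros Hfib l. remember (length l) as N eqn:HN. revert l HN.
  induction N as [N IH] using (well_founded_induction lt_wf); intros l HN ND.
  destruct l as [|a l]; [exists nil; repeat split; [constructor | subst; easy | intros y []]|].
  set (same := fun x => if Req_EM_T (f x) (f a) then true else false).
  set (diff := fun x => negb (same x)).
  assert (Hs : forall x, same x = true <-> f x = f a)
    by (intros x; unfold same; destruct (Req_EM_T (f x) (f a)); split; easy).
  assert (Hd : forall x, diff x = true <-> f x <> f a)
    by (intros x; unfold diff, same; destruct (Req_EM_T (f x) (f a)); simpl; split; easy).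
  assert (Hlen : (length (filter same (a :: l)) + length (filter diff (a :: l)) = N)%nat).
  { rewrite HN. apply (filter_length same). }
  assert (Hlt : (length (filter diff (a :: l)) < N)%nat).
  { assert (0 < length (filter same (a :: l)))%nat; [|lia].
    simpl. rewrite (proj2 (Hs a) eq_refl). simpl; lia. }
  destruct (IH _ Hlt (filter diff (a :: l)) eq_refl (NoDup_filter _ ND)) as (l2 & ND2 & L2 & H2).
  destruct (Hfib (filter same (a :: l)) (f a) (NoDup_filter _ ND)) as (l1 & ND1 & L1 & H1).
  { intros x Hx. apply filter_In in Hx as [_ Hx]. now apply Hs. }
  exists (l1 ++ l2). repeat split.
  - apply NoDup_app; auto. intros y Hy1 Hy2. apply H1 in Hy1. apply H2 in Hy2 as [x [Hx E]].
    apply filter_In in Hx as [_ Hx]. apply Hd in Hx. congruence.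
  - rewrite length_app. lia.
  - intros y Hy. apply in_app_iff in Hy as [Hy | Hy].
    + exists a; split; [now left | auto].
    + apply H2 in Hy as [x [Hx E]]. exists x; split; [|easy]. now apply filter_In in Hx.
Qed.

(** * The Steklov problem on the flat cylinder *)

Lemma constant_on_interval (F : R -> R) (a b : R) : a < b ->
  (forall t, ex_derive F t) -> (forall t, a < t < b -> is_derive F t 0) -> F b = F a.
Proof.
  intros Hab He Hd. destruct (MVT_gen F a b (fun _ => 0)) as [c [_ E]].
  - rewrite Rmin_left, Rmax_right by lra; exact Hd.
  - intros t _. apply continuity_pt_filterlim, (ex_derive_continuous F), He.
  - lra.
Qed.

Lemma continuity_2d_pt_snd V t th : continuity_2d_pt V t th -> continuous (V t) th.
Proof.
  intros H. apply (proj1 (continuity_pt_filterlim _ _)). intros e He.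
  destruct (H (mkposreal e He)) as [d Hd]. exists d; split; [apply cond_pos|].
  intros y [_ Hy]. apply Hd; [rewrite Rminus_diag, Rabs_R0; apply cond_pos | exact Hy].
Qed.

(** Differentiation under the integral sign. *)
Lemma fourier_derivative (V : R -> R -> R) r t :
  (forall t th, ex_derive (fun s => V s th) t) ->
  (forall t th, continuity_2d_pt V t th) -> (forall t th, continuity_2d_pt (d_t V) t th) ->
  is_derive (fun t => fourier (V t) r) t (fourier (d_t V t) r).
Proof.
  intros He Hc Hd.
  assert (D : forall u th, Derive (fun s => V s th * trig r th) u = d_t V u th * trig r th).
  { intros u th. unfold d_t. apply Derive_scal_l. }
  unfold fourier. rewrite <- (RInt_ext (fun th => Derive (fun s => V s th * trig r th) t))
    by (intros; apply D).
  apply (is_derive_RInt_param (fun s th => V s th * trig r th)).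
  - apply filter_forall; intros s th _. assert (E := He s th). auto_derive; exact E.
  - intros th _. apply (continuity_2d_pt_ext (fun u v => d_t V u v * trig r v)).
    + intros; symmetry; apply D.
    + apply continuity_2d_pt_mult; [apply Hd|].
      apply (continuity_1d_2d_pt_comp (trig r) (fun _ v => v)); [|apply continuity_2d_pt_id2].
      apply continuity_pt_filterlim, trig_continuous.
  - apply filter_forall; intros s. apply ex_RInt_mult_trig; intros th.
    apply continuity_2d_pt_snd, Hc.
Qed.

Lemma fourier_ext v w r : (forall x, v x = w x) -> fourier v r = fourier w r.
Proof. intros H; apply RInt_ext; intros; now rewrite H. Qed.

Lemma fourier_scal c v r : (forall x, continuous v x) ->
  fourier (fun x => c * v x) r = c * fourier v r.
Proof.
  intros Hv; apply RInt_value.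
  refine (is_RInt_ext_eq _ _ _ _ _ (is_RInt_scal _ _ _ c _ (fourier_is_RInt v r Hv)) _).
  intros x; unfold scal; simpl; unfold mult; simpl; ring.
Qed.

Lemma fourier_plus v w r : (forall x, continuous v x) -> (forall x, continuous w x) ->
  fourier (fun x => v x + w x) r = fourier v r + fourier w r.
Proof.
  intros Hv Hw; apply RInt_value.
  refine (is_RInt_ext_eq _ _ _ _ _
    (is_RInt_plus _ _ _ _ _ _ (fourier_is_RInt v r Hv) (fourier_is_RInt w r Hw)) _).
  intros x; unfold plus; simpl; ring.
Qed.

Lemma sum_continuous (v : nat -> R -> R) m : (forall i x, continuous (v i) x) ->
  forall x, continuous (fun x => sum_n_m (fun i => v i x) 1 m) x.
Proof.
  intros Hv x; induction m as [|m IH].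
  - apply (continuous_ext (fun _ => 0)); [intros; symmetry; apply sum_n_m_1_0 | apply continuous_const].
  - apply (continuous_ext (fun x => sum_n_m (fun i => v i x) 1 m + v (S m) x)).
    + intros y; symmetry; apply sum_n_m_1_S.
    + apply (continuous_plus (fun x => sum_n_m (fun i => v i x) 1 m)); [exact IH | apply Hv].
Qed.

Lemma fourier_sum (v : nat -> R -> R) m r : (forall i x, continuous (v i) x) ->
  fourier (fun x => sum_n_m (fun i => v i x) 1 m) r = sum_n_m (fun i => fourier (v i) r) 1 m.
Proof.
  intros Hv; induction m as [|m IH].
  - rewrite sum_n_m_1_0.
    rewrite (fourier_ext _ (fun x => 0 * trig 0 x)) by (intros; rewrite sum_n_m_1_0; ring).
    rewrite fourier_scal by apply trig_continuous. ring.
  - rewrite sum_n_m_1_S, <- IH, <- fourier_plus by auto using sum_continuous.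
    apply fourier_ext; intros; apply sum_n_m_1_S.
Qed.

Section Flat.
Variables a b T : R.
Hypotheses (Ha : 0 < a) (Hb : 0 < b) (HT : 0 < T).

(** The Fourier coefficient A(t) of a solution satisfies A'' = w^2 A inside the
    cylinder, so A' cosh (w t) - w^2 A shc w t and A' shc w t - A cosh (w t) are
    constant.  Equating their values at 0 and T, where A' is given by the Steklov
    condition, yields the two relations. *)
Lemma flat_fourier s u r : flat_steklov a b T s u ->
  fourier (u false) r = fourier (u true) r * (cosh (freq r * T) - s * b * shc (freq r) T)
  /\ fourier (u true) r * steklov_poly a b T (freq r) s = 0.
Proof.
  intros (Hu & U & HU & Hper & Hharm & Hbd & H0 & H1).
  set (w := freq r).
  destruct (HU 3%nat) as (D1 & (D2 & (D3 & C3 & _) & _) & (D4 & _ & (_ & _ & C4))).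
  destruct (HU 2%nat) as (_ & (_ & C2t & _) & _).
  destruct (HU 1%nat) as (_ & C1 & _). assert (C0 := HU 0%nat).
  simpl in D1, D2, D3, D4, C0, C1, C2t, C3, C4.
  assert (C2 : forall t th, continuity_2d_pt (d_th (d_th U)) t th)
    by (destruct (HU 2%nat) as (_ & _ & (_ & _ & C)); exact C).
  set (A := fun t => fourier (U t) r).
  set (A1 := fun t => fourier (d_t U t) r).
  set (A2 := fun t => fourier (d_t (d_t U) t) r).
  assert (DA : forall t, is_derive A t (A1 t)).
  { intros t; exact (fourier_derivative U r t (fun t th => proj1 (D1 t th)) C0 C1). }
  assert (DA1 : forall t, is_derive A1 t (A2 t)).
  { intros t; exact (fourier_derivative (d_t U) r t (fun t th => proj1 (D2 t th)) C1 C2t). }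
  assert (EA : forall t, 0 < t < T -> A2 t = w ^ 2 * A t).
  { intros t Ht. unfold A2, A.
    rewrite (fourier_ext _ (fun th => -1 * d_th (d_th U) t th))
      by (intros th; generalize (Hharm t th Ht); lra).
    rewrite fourier_scal by (intros; apply continuity_2d_pt_snd, C2).
    rewrite (fourier_second_derivative (U t) (d_th U t) (d_th (d_th U) t)).
    - unfold w; ring.
    - intros x; apply Derive_correct, D1.
    - intros x; apply Derive_correct, D4.
    - intros; apply continuity_2d_pt_snd, C2.
    - apply Hper.
    - intros x. unfold d_th. symmetry. rewrite (Derive_ext (fun s0 => U t s0) (fun s0 => U t (s0 + 2 * PI)))
        by (intros; symmetry; apply Hper).
      apply is_derive_unique.
      replace (Derive (fun s0 => U t s0) (x + 2 * PI)) with (scal 1 (Derive (fun s0 => U t s0) (x + 2 * PI)))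
        by (unfold scal; simpl; unfold mult; simpl; ring).
      apply (is_derive_comp (fun s0 => U t s0) (fun x => x + 2 * PI)).
      + apply Derive_correct, D1.
      + auto_derive; auto. }
  (* The two first integrals of A'' = w^2 A. *)
  assert (DF : forall t, is_derive (fun t => A1 t * cosh (w * t) - w ^ 2 * (A t * shc w t)) t
                ((A2 t - w ^ 2 * A t) * cosh (w * t))).
  { intros t. assert (E1 := DA t). assert (E2 := DA1 t). assert (E3 := shc_derive w t).
    assert (E4 := cosh_derive_shc w t).
    replace ((A2 t - w ^ 2 * A t) * cosh (w * t)) with
      (minus (plus (mult (A2 t) (cosh (w * t))) (mult (A1 t) (w ^ 2 * shc w t)))
         (w ^ 2 * plus (mult (A1 t) (shc w t)) (mult (A t) (cosh (w * t)))))
      by (unfold minus, plus, opp, mult; simpl; ring).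
    apply (is_derive_minus (fun t => A1 t * cosh (w * t)) (fun t => w ^ 2 * (A t * shc w t)));
      [|apply (is_derive_scal (fun t => A t * shc w t))].
    - apply (is_derive_mult A1 (fun t => cosh (w * t))); auto using Rmult_comm.
    - apply (is_derive_mult A (shc w)); auto using Rmult_comm. }
  assert (DG : forall t, is_derive (fun t => A1 t * shc w t - A t * cosh (w * t)) t
                ((A2 t - w ^ 2 * A t) * shc w t)).
  { intros t. assert (E1 := DA t). assert (E2 := DA1 t). assert (E3 := shc_derive w t).
    assert (E4 := cosh_derive_shc w t).
    replace ((A2 t - w ^ 2 * A t) * shc w t) with
      (minus (plus (mult (A2 t) (shc w t)) (mult (A1 t) (cosh (w * t))))
         (plus (mult (A1 t) (cosh (w * t))) (mult (A t) (w ^ 2 * shc w t))))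
      by (unfold minus, plus, opp, mult; simpl; ring).
    apply (is_derive_minus (fun t => A1 t * shc w t) (fun t => A t * cosh (w * t))).
    - apply (is_derive_mult A1 (shc w)); auto using Rmult_comm.
    - apply (is_derive_mult A (fun t => cosh (w * t))); auto using Rmult_comm. }
  assert (F := constant_on_interval _ 0 T HT (fun t => ex_intro _ _ (DF t))).
  assert (G := constant_on_interval _ 0 T HT (fun t => ex_intro _ _ (DG t))).
  lapply F; [clear F; intros F|
    intros t Ht; replace 0 with ((A2 t - w ^ 2 * A t) * cosh (w * t)); [apply DF | rewrite EA by easy; ring]].
  lapply G; [clear G; intros G|
    intros t Ht; replace 0 with ((A2 t - w ^ 2 * A t) * shc w t); [apply DG | rewrite EA by easy; ring]].
  cbv beta in F, G. rewrite Rmult_0_r, cosh_0, shc_0 in F, G.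
  assert (X0 : A 0 = fourier (u false) r) by exact (fourier_ext (U 0) (u false) r (Hbd false)).
  assert (XT : A T = fourier (u true) r) by exact (fourier_ext (U T) (u true) r (Hbd true)).
  assert (Cu : forall e x, continuous (u e) x).
  { intros e x. apply smooth1_continuous, Hu. }
  assert (Y0 : A1 0 = - (s * a) * A 0).
  { rewrite X0. unfold A1. rewrite <- fourier_scal by apply Cu.
    apply fourier_ext; intros; rewrite H0; ring. }
  assert (YT : A1 T = s * b * A T).
  { rewrite XT. unfold A1. rewrite <- fourier_scal by apply Cu.
    apply fourier_ext; intros; rewrite H1; ring. }
  rewrite <- X0, <- XT. rewrite Y0, YT in F. rewrite Y0, YT in G.
  assert (X : A 0 = A T * (cosh (w * T) - s * b * shc w T)) by lra.
  split; [exact X|]. rewrite X in F. unfold steklov_poly. lra.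
Qed.

(** A label is the index of a trigonometric function together with the choice of a root
    of its quadratic. *)
Definition eigenvalue (x : nat * bool) : R := steklov_root a b T (freq (fst x)) (snd x).

(** The boundary values of the eigenfunction of a label, whose factor depending on t is
    normalised to be 1 at t = T. *)
Definition mode (x : nat * bool) : bfun := fun e th =>
  (if e then 1 else cosh (freq (fst x) * T) - eigenvalue x * b * shc (freq (fst x)) T) * trig (fst x) th.

Lemma mode_flat_steklov x : flat_steklov a b T (eigenvalue x) (mode x).
Proof.
  destruct x as [r sg]. set (s := eigenvalue (r, sg)). set (w := freq r).
  split.
  - intros e; split; [apply smooth1_scal, smooth1_trig|].
    intros th; unfold mode; now rewrite trig_periodic.
  (* P solves P'' = w^2 P with P = 1 and P' = s b at t = T. *)
  - set (P := fun t => cosh (w * (T - t)) - s * b * shc w (T - t)).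
    set (P1 := fun t => - (w ^ 2 * shc w (T - t)) + s * b * cosh (w * (T - t))).
    assert (DR : forall t, is_derive (fun t => T - t) t (-1)) by (intros; auto_derive; auto; ring).
    assert (DP : forall t, is_derive P t (P1 t)).
    { intros t. replace (P1 t) with (minus (scal (-1) (w ^ 2 * shc w (T - t))) (s * b * (scal (-1) (cosh (w * (T - t))))))
        by (unfold P1, minus, plus, opp, scal; simpl; unfold mult; simpl; ring).
      apply (is_derive_minus (fun t => cosh (w * (T - t))) (fun t => s * b * shc w (T - t)));
        [|apply (is_derive_scal (fun t => shc w (T - t)))].
      - apply (is_derive_comp (fun t => cosh (w * t)) (fun t => T - t)); [apply cosh_derive_shc | apply DR].
      - apply (is_derive_comp (shc w) (fun t => T - t)); [apply shc_derive | apply DR]. }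
    assert (DP1 : forall t, is_derive P1 t (w ^ 2 * P t)).
    { intros t. replace (w ^ 2 * P t) with (plus (opp (w ^ 2 * (scal (-1) (cosh (w * (T - t))))))
         (s * b * (scal (-1) (w ^ 2 * shc w (T - t)))))
        by (unfold P, plus, opp, scal; simpl; unfold mult; simpl; ring).
      apply (is_derive_plus (fun t => - (w ^ 2 * shc w (T - t))) (fun t => s * b * cosh (w * (T - t))));
        [apply (is_derive_opp (fun t => w ^ 2 * shc w (T - t))), (is_derive_scal (fun t => shc w (T - t)))
        |apply (is_derive_scal (fun t => cosh (w * (T - t))))].
      - apply (is_derive_comp (shc w) (fun t => T - t)); [apply shc_derive | apply DR].
      - apply (is_derive_comp (fun t => cosh (w * t)) (fun t => T - t)); [apply cosh_derive_shc | apply DR]. }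
    assert (SP : smooth1 P) by exact (smooth1_ode _ _ _ DP DP1).
    assert (SQ := smooth1_trig r).
    assert (EP : Derive P = P1) by (apply functional_extensionality; intros; apply is_derive_unique, DP).
    assert (EP1 : Derive P1 = fun t => w ^ 2 * P t) by (apply functional_extensionality; intros; apply is_derive_unique, DP1).
    assert (EQ : Derive (trig r) = dtrig r) by (apply functional_extensionality; intros; apply is_derive_unique, trig_derive).
    assert (EQ1 : Derive (dtrig r) = fun x => - w ^ 2 * trig r x)
      by (apply functional_extensionality; intros; apply is_derive_unique, dtrig_derive).
    exists (fun t th => P t * trig r th). split; [now apply smooth2_prod|].
    split; [intros t th; now rewrite trig_periodic|].
    rewrite (d_t_prod P), (d_th_prod P) by easy. rewrite EP, EQ.
    rewrite (d_t_prod P1) by (rewrite <- EP; now apply smooth1_Derive).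
    rewrite (d_th_prod P (dtrig r)) by (rewrite <- EQ; now apply smooth1_Derive).
    rewrite EP1, EQ1.
    split; [intros; ring|]. unfold P, P1, mode; cbn [fst snd edge]. fold s w.
    split; [|split].
    + intros [|] th; simpl edge.
      * rewrite Rminus_diag, Rmult_0_r, cosh_0, shc_0. ring.
      * rewrite Rminus_0_r. easy.
    + intros th. rewrite Rminus_0_r.
      assert (E := steklov_poly_root a b T Ha Hb HT w sg (freq_nonneg r)). change (steklov_root a b T w sg) with s in E.
      unfold steklov_poly in E. 
      replace (- (w ^ 2 * shc w T) + s * b * cosh (w * T))
        with (- (s * a * (cosh (w * T) - s * b * shc w T))) by lra. ring.
    + intros th. rewrite Rminus_diag, Rmult_0_r, cosh_0, shc_0. ring.
Qed.

Lemma mode_continuous x e th : continuous (mode x e) th.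
Proof. apply smooth1_continuous, smooth1_scal, smooth1_trig. Qed.

Lemma fourier_mode_true x r : fourier (mode x true) r = fourier (trig (fst x)) r.
Proof. apply fourier_ext; intros; unfold mode; ring. Qed.

Lemma fourier_mode_other x r e : r <> fst x -> fourier (mode x e) r = 0.
Proof.
  intros H. unfold mode. rewrite fourier_scal by apply trig_continuous.
  rewrite trig_orthogonal by easy. ring.
Qed.

(** The two roots of one frequency differ, so the modes of one eigenvalue belong to
    different trigonometric functions and are independent. *)
Lemma eigenvalue_inj r sg sg' : eigenvalue (r, sg) = eigenvalue (r, sg') -> sg = sg'.
Proof.
  assert (H := steklov_root_lt a b T Ha Hb HT (freq r) (freq_nonneg r)).
  unfold eigenvalue; simpl. destruct sg, sg'; intros; auto; lra.
Qed.

(** An eigenfunction u has, by flat_fourier, the Fourier coefficients of a multiple of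
    mode for each label of eigenvalue s, and zero coefficients at all other indices.
    So u minus the sum of these multiples vanishes by completeness. *)
Lemma flat_has_dim s L : NoDup L -> (forall x, In x L <-> eigenvalue x = s) ->
  has_dim (flat_steklov a b T s) (length L).
Proof.
  intros ND HL. set (x0 := (0%nat, false)). set (x := fun i => nth (i - 1) L x0).
  assert (Hx : forall i, (1 <= i <= length L)%nat -> eigenvalue (x i) = s).
  { intros i Hi. apply HL, nth_In. lia. }
  assert (Hinj : forall i j, (1 <= i <= length L)%nat -> (1 <= j <= length L)%nat -> j <> i ->
             fst (x i) <> fst (x j)).
  { intros i j Hi Hj Hne E. assert (Ei := Hx i Hi). rewrite <- (Hx j Hj) in Ei.
    assert (X : x i = x j).
    { destruct (x i) as [r sg], (x j) as [r' sg']. simpl in E; subst r'. f_equal. now apply eigenvalue_inj in Ei. }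
    apply (proj1 (NoDup_nth L x0) ND) in X; lia. }
  assert (Cm : forall c : nat -> R, forall e i th, continuous (fun th => c i * mode (x i) e th) th).
  { intros c e i th. apply (continuous_scal_r (c i) (mode (x i) e)), mode_continuous. }
  assert (Fl : forall c e r, fourier (lincomb (length L) c (fun i => mode (x i)) e) r
            = sum_n_m (fun i => c i * fourier (mode (x i) e) r) 1 (length L)).
  { intros c e r. unfold lincomb. rewrite (fourier_sum (fun i th => c i * mode (x i) e th)) by apply Cm.
    apply sum_n_m_eq; intros. apply fourier_scal, mode_continuous. }
  exists (fun i => mode (x i)). split; [|split].
  - intros i Hi. rewrite <- (Hx i Hi). apply mode_flat_steklov.
  - intros c Hc i Hi. assert (F := Fl c true (fst (x i))).
    rewrite (fourier_ext _ (fun th => 0 * trig 0 th)), fourier_scal, Rmult_0_l in F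
      by (try apply trig_continuous; intros; rewrite Hc; ring).
    rewrite (sum_n_m_single _ i) in F; [|easy|].
    + rewrite fourier_mode_true in F. symmetry in F. apply Rmult_integral in F as [F | F]; [easy|].
      generalize (trig_norm_pos (fst (x i))); lra.
    + intros j Hj Hne. rewrite fourier_mode_other; [ring|]. auto.
  - intros u Hu.
    (* Coefficients are read off at t = T, where the modes are trigonometric functions. *)
    set (c := fun i => fourier (u true) (fst (x i)) / fourier (trig (fst (x i))) (fst (x i))).
    exists c. intros e th. apply Rminus_diag_uniq.
    set (l := lincomb (length L) c (fun i => mode (x i)) e).
    assert (Cl : forall th, continuous l th)
      by (intros; apply (sum_continuous (fun i th => c i * mode (x i) e th)); intros; apply Cm).
    assert (Cu : forall th, continuous (u e) th) by (intros; apply smooth1_continuous, (proj1 Hu e)).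
    change (u e th - l th = 0). replace (u e th - l th) with (u e th + -1 * l th) by ring.
    apply (fourier_complete (fun th => u e th + -1 * l th)).
    + intros y. apply (continuous_plus (u e) (fun th => -1 * l th)); [apply Cu|].
      apply (continuous_scal_r (-1) l), Cl.
    + intros y. rewrite (proj2 (proj1 Hu e)). do 2 f_equal. apply sum_n_m_eq; intros i _.
      unfold mode; now rewrite trig_periodic.
    + intros r. assert (Fr := Fl c e r). fold l in Fr. rewrite fourier_plus, fourier_scal, Fr; auto.
      2: { intros; apply (continuous_scal_r (-1) l), Cl. }
      destruct (flat_fourier s u r Hu) as [F0 F1].
      destruct (classic (exists i, (1 <= i <= length L)%nat /\ fst (x i) = r)) as [[i [Hi Hr]] | Hno].
      * rewrite (sum_n_m_single _ i); [|easy|].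
        2: { intros j Hj Hne. rewrite fourier_mode_other; [ring|]. rewrite <- Hr. auto. }
        assert (N := trig_norm_pos r).
        destruct e.
        -- rewrite fourier_mode_true. unfold c. rewrite Hr. field; lra.
        -- unfold mode. rewrite fourier_scal by apply trig_continuous. unfold c.
           rewrite (Hx i Hi), Hr, F0. field; lra.
      * rewrite sum_n_m_all_0.
        2: { intros j Hj. rewrite fourier_mode_other; [ring|]. intros E; apply Hno; exists j; auto. }
        assert (Z : fourier (u true) r = 0).
        { apply Rmult_integral in F1 as [F1 | F1]; [easy|]. exfalso.
          apply steklov_poly_eq_0 in F1 as [sg E]; [|lra..|apply freq_nonneg].
          assert (I : In (r, sg) L) by now apply HL.
          apply (In_nth _ _ x0) in I as [n [Hn En]]. apply Hno. exists (S n). split; [lia|].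
          unfold x. replace (S n - 1)%nat with n by lia. now rewrite En. }
        destruct e; [rewrite Z | rewrite F0, Z]; ring.
Qed.

(** The smaller root of frequency k is at least k tanh (kT) / (a + b), which tends to
    infinity. *)
Lemma eigenvalue_sublevel_finite s : exists L, forall x, eigenvalue x <= s -> In x L.
Proof.
  assert (Hth := tanh_pos T HT).
  destruct (INR_unbounded (s * (a + b) / tanh T)) as [N HN].
  exists (list_prod (seq 0 (2 * N + 1)) (true :: false :: nil)).
  intros [r sg] Hx. apply in_prod; [|destruct sg; simpl; auto].
  apply in_seq. split; [lia|]. 
  destruct (Nat.lt_ge_cases r (0 + (2 * N + 1))) as [|Hr]; [easy|exfalso].
  assert (Hf : INR N + 1 <= freq r).
  { unfold freq. rewrite <- S_INR. apply le_INR. rewrite Nat.div2_div.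
    apply Nat.div_le_lower_bound; lia. }
  assert (HN0 := pos_INR N).
  assert (R1 := steklov_root_false_ge a b T Ha Hb HT (freq r) ltac:(lra)).
  assert (R2 := steklov_root_lt a b T Ha Hb HT (freq r) (freq_nonneg r)).
  assert (R3 : steklov_root a b T (freq r) false <= s) by (unfold eigenvalue in Hx; simpl in Hx; destruct sg; lra).
  assert (tanh T <= tanh (freq r * T)) by (apply tanh_le; nra).
  assert (R4 : freq r * tanh (freq r * T) <= s * (a + b)).
  { apply (Rmult_le_reg_r (/ (a + b))); [apply Rinv_0_lt_compat; lra|].
    replace (s * (a + b) * / (a + b)) with s by (field; lra). unfold Rdiv in R1; lra. }
  assert (R5 : s * (a + b) < INR N * tanh T).
  { apply (Rmult_lt_reg_r (/ tanh T)); [now apply Rinv_0_lt_compat|].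
    replace (INR N * tanh T * / tanh T) with (INR N) by (field; lra). exact HN. }
  nra.
Qed.

Lemma eigenvalue_fiber s : exists L, NoDup L /\ forall x, In x L <-> eigenvalue x = s.
Proof.
  destruct (eigenvalue_sublevel_finite s) as [L HL].
  assert (dec : forall x y : nat * bool, {x = y} + {x <> y}) by (repeat decide equality).
  exists (filter (fun x => if Req_EM_T (eigenvalue x) s then true else false) (nodup dec L)).
  split; [apply NoDup_filter, NoDup_nodup|].
  intros x. rewrite filter_In, nodup_In. destruct (Req_EM_T (eigenvalue x) s); split; try easy.
  intros _; split; [apply HL; lra | easy].
Qed.

Lemma eigenvalue_card_fiber (p : nat -> nat * bool) s L :
  (forall i j, p i = p j -> i = j) -> (forall x, exists k, p k = x) ->
  NoDup L -> (forall x, In x L <-> eigenvalue x = s) -> has_card (fun k => eigenvalue (p k) = s) (length L).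
Proof.
  intros Hi Hs ND HL.
  set (q := fun x => proj1_sig (constructive_indefinite_description _ (Hs x))).
  assert (Hq : forall x, p (q x) = x)
    by (intros x; exact (proj2_sig (constructive_indefinite_description _ (Hs x)))).
  exists (map q L). split; [|split].
  - apply NoDup_map_NoDup_ForallPairs; [|exact ND]. intros x y _ _ E.
    rewrite <- (Hq x), <- (Hq y), E. reflexivity.
  - apply length_map.
  - intros k. rewrite in_map_iff. split.
    + intros [x [<- Hx]]. rewrite Hq. now apply HL.
    + intros E. exists (p k). split; [apply Hi, Hq | now apply HL].
Qed.

End Flat.

(** * The spectrum of a rotationally symmetric metric *)

Lemma has_dim_ext (E E' : bfun -> Prop) m : (forall u, E u <-> E' u) -> has_dim E m -> has_dim E' m.
Proof.
  intros H (e & He & Hi & Hs). exists e. split; [|split; [exact Hi|]].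
  - intros i Hi'. now apply H, He.
  - intros u Hu. now apply Hs, H.
Qed.

Lemma NoDup_sublist {B} (P : B -> Prop) l : NoDup l -> (forall x, In x l -> P x) ->
  forall k, (k <= length l)%nat -> exists l', NoDup l' /\ length l' = k /\ forall x, In x l' -> P x.
Proof.
  intros ND H k Hk. exists (firstn k l). split; [|split].
  - rewrite <- (firstn_skipn k l) in ND. now apply NoDup_app_remove_r in ND.
  - now apply firstn_length_le.
  - intros x Hx. apply H. rewrite <- (firstn_skipn k l). apply in_app_iff; now left.
Qed.

Section Spectrum.
Variables (g : metric) (T : R) (f : R -> R).
Hypothesis HT : 0 < T.
Hypothesis Hf : forall t, 0 <= t <= T -> 0 < f t.
Hypothesis Hg : forall t th, 0 <= t <= T ->
  gE g t th = f t ^ 2 /\ gF g t th = 0 /\ gG g t th = f t ^ 2.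
Let a := f 0.
Let b := f T.

Lemma radius_0_pos : 0 < a. Proof. apply Hf; lra. Qed.
Lemma radius_T_pos : 0 < b. Proof. apply Hf; lra. Qed.

Lemma steklov_dim s L : NoDup L -> (forall x, In x L <-> eigenvalue a b T x = s) ->
  has_dim (steklov_eigenspace g T s) (length L).
Proof.
  intros ND HL. apply (has_dim_ext (flat_steklov a b T s)).
  - intros u; symmetry; now apply conformal_eigenspace.
  - apply flat_has_dim; auto using radius_0_pos, radius_T_pos.
Qed.

(** The spectrum is chosen by the epsilon operator, so nothing is known about it until
    some sequence with the required multiplicities is exhibited: the sorted labels. *)
Lemma steklov_is_spectrum : steklov_spectrum g T (steklov g T).
Proof.
  unfold steklov. apply epsilon_spec.
  destruct (sort_enumeration (eigenvalue a b T)) as (p & Hmono & Hinj & Hsurj).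
  - intros s; apply eigenvalue_sublevel_finite; auto using radius_0_pos, radius_T_pos.
  - intros l. 
    assert (ND : NoDup (map (fun r => (r, false)) (seq 0 (S (length l))))).
    { apply NoDup_map_NoDup_ForallPairs; [|apply seq_NoDup]. intros i j _ _ E; now injection E. }
    apply NNPP; intros H. apply (Nat.nle_succ_diag_l (length l)).
    rewrite <- (length_seq (S (length l)) 0) at 1. rewrite <- (length_map (fun r => (r, false))).
    apply (NoDup_incl_length ND). intros x _. apply NNPP; intros Hx; apply H; eauto.
  - exists (fun k => eigenvalue a b T (p k)). split; [exact Hmono|].
    intros s. destruct (eigenvalue_fiber a b T radius_0_pos radius_T_pos HT s) as [L [ND HL]].
    exists (length L). split; [now apply steklov_dim | now apply eigenvalue_card_fiber].
Qed.

Lemma steklov_mono i j : (i <= j)%nat -> steklov g T i <= steklov g T j.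
Proof.
  intros H; induction H as [|j _ IH]; [lra|].
  apply Rle_trans with (1 := IH), (proj1 steklov_is_spectrum).
Qed.

Lemma steklov_fiber s : exists L l,
  NoDup L /\ (forall x, In x L <-> eigenvalue a b T x = s) /\
  NoDup l /\ (forall k, In k l <-> steklov g T k = s) /\ length l = length L.
Proof.
  destruct (eigenvalue_fiber a b T radius_0_pos radius_T_pos HT s) as [L [ND HL]].
  destruct (proj2 steklov_is_spectrum s) as [m [Hm [l [NDl [Hlen Hl]]]]].
  exists L, l. repeat split; auto; try apply HL; try apply Hl.
  rewrite Hlen. apply (has_dim_unique _ _ _ Hm). now apply steklov_dim.
Qed.

(** Otherwise all indices with eigenvalue at most s would be below k, while by equality
    of multiplicities there are as many of them as there are such labels. *)
Lemma steklov_le k s l : NoDup l -> (k < length l)%nat ->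
  (forall x, In x l -> eigenvalue a b T x <= s) -> steklov g T k <= s.
Proof.
  intros ND Hk Hl. apply Rnot_lt_le; intros Hs.
  destruct (transfer_distinct (eigenvalue a b T) (steklov g T)) with (l := l) as (l' & ND' & L' & H').
  - intros l0 s0 ND0 H0. destruct (steklov_fiber s0) as (L & l1 & NDL & HL & ND1 & H1 & HLen).
    apply (NoDup_sublist _ l1); auto; [apply H1|].
    rewrite HLen. apply (NoDup_incl_length ND0). intros x Hx. now apply HL, H0.
  - exact ND.
  - assert (I : incl l' (seq 0 k)).
    { intros i Hi. destruct (H' i Hi) as [x [Hx E]]. apply in_seq. split; [lia|].
      apply Nat.nle_gt; intros Hki. apply (steklov_mono k i) in Hki. specialize (Hl x Hx). lra. }
    apply (NoDup_incl_length ND') in I. rewrite length_seq in I. lia.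
Qed.

Lemma steklov_ge k s L : (length L <= k)%nat ->
  (forall x, eigenvalue a b T x < s -> In x L) -> s <= steklov g T k.
Proof.
  intros Hk HL. apply Rnot_lt_le; intros Hs.
  destruct (transfer_distinct (steklov g T) (eigenvalue a b T)) with (l := seq 0 (S k)) as (l' & ND' & L' & H').
  - intros l0 s0 ND0 H0. destruct (steklov_fiber s0) as (L1 & l1 & NDL & HL1 & ND1 & H1 & HLen).
    apply (NoDup_sublist _ L1); auto; [apply HL1|].
    rewrite <- HLen. apply (NoDup_incl_length ND0). intros x Hx. now apply H1, H0.
  - apply seq_NoDup.
  - assert (I : incl l' L).
    { intros y Hy. destruct (H' y Hy) as [i [Hi E]]. apply HL. rewrite E.
      apply in_seq in Hi. apply Rle_lt_trans with (2 := Hs). apply steklov_mono. lia. }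
    apply (NoDup_incl_length ND') in I. rewrite L', length_seq in I. lia.
Qed.

(** The 4n + 1 labels are obtained injectively from r = 0, ..., 4n: take the smaller root
    of index r if it is small enough, and the larger root of index 4n + 1 - r otherwise.
    If r has frequency k, then 4n + 1 - r has frequency 2n + 1 - k. *)
Lemma normalized_steklov_upper n x : (1 <= n)%nat -> 0 < x ->
  INR (2 * n) * tanh (INR (2 * n) * x) = coth x ->
  normalized_steklov (4 * n) g T <= 4 * PI * coth x.
Proof.
  intros Hn Hx E. assert (H1 := radius_0_pos). assert (H2 := radius_T_pos). assert (Pi := PI_RGT_0).
  assert (Hm : 2 <= INR (2 * n)) by (apply (le_INR 2); lia).
  set (s0 := 2 * coth x / (a + b)).
  assert (Hs : steklov g T (4 * n) <= s0).
  { set (phi := fun r => if Rle_dec (eigenvalue a b T (r, false)) s0 then (r, false) else ((4 * n + 1 - r)%nat, true)).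
    apply (steklov_le _ _ (map phi (seq 0 (4 * n + 1)))).
    - apply NoDup_map_NoDup_ForallPairs; [|apply seq_NoDup].
      intros i j Hi Hj. apply in_seq in Hi, Hj. unfold phi.
      destruct (Rle_dec _ _), (Rle_dec _ _); intros Eq; injection Eq; try easy; lia.
    - rewrite length_map, length_seq. lia.
    - intros y Hy. apply in_map_iff in Hy as [r [<- Hr]]. apply in_seq in Hr. unfold phi.
      destruct (Rle_dec _ _) as [|Hbig]; [easy|].
      unfold eigenvalue in *; cbn [fst snd] in *. unfold freq in *.
      set (k := Nat.div2 (S r)) in *.
      replace (Nat.div2 (S (4 * n + 1 - r))) with (2 * n + 1 - k)%nat.
      2: { unfold k. rewrite !Nat.div2_div. 
           generalize (Nat.div_mod_eq (S r) 2) (Nat.div_mod_eq (S (4 * n + 1 - r)) 2)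
             (Nat.mod_upper_bound (S r) 2 ltac:(lia)) (Nat.mod_upper_bound (S (4 * n + 1 - r)) 2 ltac:(lia)). lia. }
      assert (Hkn : (n < k)%nat).
      { apply Nat.nle_gt; intros Hkn. apply Hbig.
        apply (steklov_root_false_low a b T H1 H2 HT (INR (2 * n)) x); auto using pos_INR.
        replace 2 with (INR 2) by easy. rewrite <- mult_INR. apply le_INR. lia. }
      assert (Hk2 : (k <= 2 * n)%nat).
      { unfold k. rewrite Nat.div2_div. apply Nat.lt_succ_r, Nat.Div0.div_lt_upper_bound; lia. }
      destruct (roots_not_both_large a b T H1 H2 HT (INR (2 * n)) x (INR (2 * n + 1 - k)) (INR k))
        as [|Hgood]; auto.
      + apply (le_INR 1); lia.
      + rewrite <- S_INR. apply le_INR; lia.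
      + apply le_INR; lia.
      + rewrite <- plus_INR, <- S_INR. f_equal; lia.
      + easy. }
  unfold normalized_steklov. rewrite (conformal_boundary_length g T f) by auto. fold a b.
  replace (4 * PI * coth x) with (s0 * (2 * PI * (a + b))) by (unfold s0; field; lra).
  apply Rmult_le_compat_r; [nra | exact Hs].
Qed.

(** Both k tanh (k x) and k coth (k x) increase with k, and they take the value coth x at
    k = 2n and at k = 1 respectively.  Hence only 4n labels have an eigenvalue below
    coth x / a. *)
Lemma normalized_steklov_lower n x : (1 <= n)%nat -> 0 < x ->
  INR (2 * n) * tanh (INR (2 * n) * x) = coth x -> T = 2 * x -> a = b ->
  4 * PI * coth x <= normalized_steklov (4 * n) g T.
Proof.
  intros Hn Hx E HTx Hab. assert (H1 := radius_0_pos). assert (Pi := PI_RGT_0).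
  assert (Hs : coth x / a <= steklov g T (4 * n)).
  { (* The indices of frequency less than 2n are r = 0, ..., 4n - 2. *)
    apply (steklov_ge _ _ ((0%nat, true) :: map (fun r => (r, false)) (seq 0 (4 * n - 1)))).
    { simpl length. rewrite length_map, length_seq. lia. }
    intros [r sg] Hr. destruct (Nat.eq_dec r 0) as [-> | Hr0].
    { destruct sg; [now left | right]. apply (in_map (fun r => (r, false))), in_seq; lia. }
    unfold eigenvalue in Hr; cbn [fst snd] in Hr. unfold freq in Hr. set (k := Nat.div2 (S r)) in *.
    assert (Hk : (1 <= k)%nat).
    { unfold k. rewrite Nat.div2_div. apply Nat.div_le_lower_bound; lia. }
    assert (Hk' : 1 <= INR k) by (apply (le_INR 1) in Hk; exact Hk).
    rewrite <- Hab, steklov_root_equal_radii in Hr by (auto; lra).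
    replace (T / 2) with x in Hr by (rewrite HTx; field).
    apply (Rmult_lt_compat_r a) in Hr; [|easy].
    unfold Rdiv in Hr. rewrite !Rmult_assoc, Rinv_l, !Rmult_1_r in Hr by lra.
    destruct sg.
    - exfalso. assert (C := mul_coth_incr x 1 (INR k) Hx ltac:(lra)). rewrite !Rmult_1_l in C. lra.
    - right. apply (in_map (fun r => (r, false))), in_seq. split; [lia|].
      assert (Hlt : (k < 2 * n)%nat).
      { apply Nat.nle_gt; intros Hge. apply le_INR in Hge.
        assert (Hm : 2 <= INR (2 * n)) by (apply (le_INR 2); lia).
        assert (tanh (INR (2 * n) * x) <= tanh (INR k * x)) by (apply tanh_le; nra).
        assert (0 < tanh (INR (2 * n) * x)) by (apply tanh_pos; nra). nra. }
      revert Hlt; unfold k. rewrite Nat.div2_div.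
      generalize (Nat.div_mod_eq (S r) 2) (Nat.mod_upper_bound (S r) 2 ltac:(lia)). lia. }
  unfold normalized_steklov. rewrite (conformal_boundary_length g T f) by auto. fold a b.
  rewrite <- Hab. replace (4 * PI * coth x) with (coth x / a * (2 * PI * (a + a))) by (field; lra).
  apply Rmult_le_compat_r; [nra | exact Hs].
Qed.
End Spectrum.

(** * The Moebius immersion *)

Lemma moebius_X_t n t0 t th i : X_t (translate (moebius n) t0) t th i =
  match i with
  | x1 => 2 * INR n * cosh (t + t0) * cos th
  | x2 => 2 * INR n * cosh (t + t0) * sin th
  | x3 => 2 * INR n * sinh (2 * INR n * (t + t0)) * cos (2 * INR n * th)
  | x4 => 2 * INR n * sinh (2 * INR n * (t + t0)) * sin (2 * INR n * th)
  end.
Proof. destruct i; apply is_derive_unique; unfold translate, moebius; auto_derive; auto; ring. Qed.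

Lemma moebius_X_th n t0 t th i : X_th (translate (moebius n) t0) t th i =
  match i with
  | x1 => - (2 * INR n * sinh (t + t0) * sin th)
  | x2 => 2 * INR n * sinh (t + t0) * cos th
  | x3 => - (2 * INR n * cosh (2 * INR n * (t + t0)) * sin (2 * INR n * th))
  | x4 => 2 * INR n * cosh (2 * INR n * (t + t0)) * cos (2 * INR n * th)
  end.
Proof. destruct i; apply is_derive_unique; unfold translate, moebius; auto_derive; auto; ring. Qed.

Lemma translate_0 X : translate X 0 = X.
Proof. unfold translate; do 3 (apply functional_extensionality; intros); now rewrite Rplus_0_r. Qed.

(** The common value of |X_t|^2 and |X_th|^2. *)
Definition moebius_factor (n : nat) (t : R) : R :=
  (2 * INR n) ^ 2 * (cosh t ^ 2 + sinh (2 * INR n * t) ^ 2).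

Lemma moebius_conformal n t0 t th :
  let g := induced_metric (translate (moebius n) t0) in
  gE g t th = moebius_factor n (t + t0) /\ gF g t th = 0 /\ gG g t th = moebius_factor n (t + t0).
Proof.
  cbn [gE gF gG induced_metric]. unfold dot. rewrite !moebius_X_t, !moebius_X_th. unfold moebius_factor.
  set (y := t + t0). set (w := 2 * INR n). 
  assert (E1 := sin2_cos2 th). assert (E2 := sin2_cos2 (w * th)). unfold Rsqr in E1, E2.
  assert (E3 := cosh2_sinh2 y). assert (E4 := cosh2_sinh2 (w * y)).
  split; [|split; [ring|]].
  - transitivity (w ^ 2 * (cosh y ^ 2 * (sin th * sin th + cos th * cos th)
        + sinh (w * y) ^ 2 * (sin (w * th) * sin (w * th) + cos (w * th) * cos (w * th)))); [ring|].
    rewrite E1, E2; ring.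
  - transitivity (w ^ 2 * (sinh y * sinh y * (sin th * sin th + cos th * cos th)
        + cosh (w * y) * cosh (w * y) * (sin (w * th) * sin (w * th) + cos (w * th) * cos (w * th)))); [ring|].
    rewrite E1, E2, E4. replace (cosh y ^ 2) with (1 + sinh y * sinh y) by (rewrite <- E3; ring). ring.
Qed.

Lemma moebius_factor_pos n t : (1 <= n)%nat -> 0 < moebius_factor n t.
Proof.
  intros Hn. apply (lt_INR 0) in Hn. simpl in Hn. unfold moebius_factor. 
  apply Rmult_lt_0_compat; [apply pow_lt; lra|].
  generalize (pow2_ge_0 (sinh (2 * INR n * t))) (pow_lt (cosh t) 2 (cosh_pos t)). lra.
Qed.

Lemma smooth1_cosh_lin w c : smooth1 (fun t => cosh (w * (t + c))).
Proof.
  apply (smooth1_ode _ (fun t => w * sinh (w * (t + c))) (w ^ 2)); intros x; auto_derive; auto; ring.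
Qed.

Lemma smooth1_sinh_lin w c : smooth1 (fun t => sinh (w * (t + c))).
Proof.
  apply (smooth1_ode _ (fun t => w * cosh (w * (t + c))) (w ^ 2)); intros x; auto_derive; auto; ring.
Qed.

Lemma smooth1_cos_lin w : smooth1 (fun t => cos (w * t)).
Proof. apply (smooth1_ode _ (fun t => - w * sin (w * t)) (- w ^ 2)); intros x; auto_derive; auto; ring. Qed.

Lemma smooth1_sin_lin w : smooth1 (fun t => sin (w * t)).
Proof. apply (smooth1_ode _ (fun t => w * cos (w * t)) (- w ^ 2)); intros x; auto_derive; auto; ring. Qed.

Lemma smooth1_eq f h : smooth1 f -> (forall x, f x = h x) -> smooth1 h.
Proof. intros H E. now replace h with f by now apply functional_extensionality. Qed.

Lemma smooth1_moebius_factor n c : smooth1 (fun t => moebius_factor n (t + c)).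
Proof.
  apply (smooth1_scal ((2 * INR n) ^ 2)), smooth1_plus.
  - apply (smooth1_eq (fun t => cosh (1 * (t + c)) * cosh (1 * (t + c)))).
    + apply smooth1_mult; apply smooth1_cosh_lin.
    + intros x; rewrite Rmult_1_l; ring.
  - apply (smooth1_eq (fun t => sinh (2 * INR n * (t + c)) * sinh (2 * INR n * (t + c)))).
    + apply smooth1_mult; apply smooth1_sinh_lin.
    + intros x; ring.
Qed.

Lemma moebius_smooth n i : smooth2 (moebius n i).
Proof.
  assert (E : forall U P Q, smooth1 P -> smooth1 Q -> (forall t th, U t th = P t * Q th) -> smooth2 U).
  { intros U P Q HP HQ H. replace U with (fun t th => P t * Q th); [now apply smooth2_prod|].
    do 2 (apply functional_extensionality; intros); now rewrite H. }
  assert (Hs := smooth1_scal (2 * INR n) _ (smooth1_sinh_lin 1 0)).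
  assert (Hc := smooth1_cosh_lin (2 * INR n) 0).
  destruct i.
  - apply (E _ _ _ Hs (smooth1_cos_lin 1)); intros; rewrite !Rmult_1_l, Rplus_0_r; easy.
  - apply (E _ _ _ Hs (smooth1_sin_lin 1)); intros; rewrite !Rmult_1_l, Rplus_0_r; easy.
  - apply (E _ _ _ Hc (smooth1_cos_lin (2 * INR n))); intros; rewrite Rplus_0_r; easy.
  - apply (E _ _ _ Hc (smooth1_sin_lin (2 * INR n))); intros; rewrite Rplus_0_r; easy.
Qed.

Lemma moebius_dots n t th :
  dot (X_t (moebius n) t th) (X_t (moebius n) t th) = moebius_factor n t
  /\ dot (X_t (moebius n) t th) (X_th (moebius n) t th) = 0
  /\ dot (X_th (moebius n) t th) (X_th (moebius n) t th) = moebius_factor n t.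
Proof.
  assert (H := moebius_conformal n 0 t th). rewrite translate_0, Rplus_0_r in H. exact H.
Qed.

Lemma moebius_tangent_coefficients n t th p q : (1 <= n)%nat ->
  let v := fun i => p * X_t (moebius n) t th i + q * X_th (moebius n) t th i in
  (dot v (X_th (moebius n) t th) = 0 -> q = 0) /\ (dot v (X_t (moebius n) t th) = 0 -> p = 0).
Proof.
  intros Hn v. destruct (moebius_dots n t th) as (E & F & G). assert (P := moebius_factor_pos n t Hn).
  set (Xt := X_t (moebius n) t th) in *. set (Xh := X_th (moebius n) t th) in *.
  split; intros H.
  - replace (dot v Xh) with (p * dot Xt Xh + q * dot Xh Xh) in H by (unfold v, dot; ring).
    rewrite F, G in H. nra.
  - replace (dot v Xt) with (p * dot Xt Xt + q * dot Xt Xh) in H by (unfold v, dot; ring).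
    rewrite E, F in H. nra.
Qed.

Lemma moebius_immersion n a b : (1 <= n)%nat -> immersion (moebius n) a b.
Proof.
  intros Hn. split; [apply moebius_smooth|split].
  - assert (E : forall y, 2 * INR n * (y + 2 * PI) = 2 * INR n * y + 2 * INR (2 * n) * PI)
      by (intros; rewrite mult_INR; simpl; ring).
    assert (C : forall y, cos (y + 2 * PI) = cos y /\ sin (y + 2 * PI) = sin y).
    { intros y. replace (y + 2 * PI) with (y + 2 * INR 1 * PI) by (simpl; ring).
      split; [apply cos_period | apply sin_period]. }
    intros i t th; destruct i; unfold moebius; rewrite ?E, ?cos_period, ?sin_period,
      ?(proj1 (C th)), ?(proj2 (C th)); reflexivity.
  - intros t th _ p q H.
    destruct (moebius_tangent_coefficients n t th p q Hn) as [Hq Hp].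
    assert (Z : forall w, dot (fun i => p * X_t (moebius n) t th i + q * X_th (moebius n) t th i) w = 0).
    { intros w; unfold dot; rewrite !H; ring. }
    split; [apply Hp | apply Hq]; apply Z.
Qed.

Lemma moebius_factors n : factors_through_moebius (moebius n).
Proof.
  intros i t th.
  assert (E : 2 * INR n * (th + PI) = 2 * INR n * th + 2 * INR n * PI) by ring.
  assert (E' : 2 * INR n * - t = - (2 * INR n * t)) by ring.
  destruct i; unfold moebius; rewrite ?E, ?E', ?cosh_opp, ?sinh_opp, ?cos_period, ?sin_period,
    ?neg_cos, ?neg_sin; ring.
Qed.

(** A vector tangent to the surface and normal to the boundary curve is a multiple of X_t.
    On the boundary X_t = coth t X: in the first two coordinates this holds for every t,
    and in the last two it is the equation 2n tanh (2n t) = coth t. *)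
Lemma moebius_meets_ball n x : (1 <= n)%nat -> 0 < x ->
  INR (2 * n) * tanh (INR (2 * n) * x) = coth x -> meets_ball_orthogonally (moebius n) (- x) x.
Proof.
  intros Hn Hx E. set (w := 2 * INR n).
  assert (Hw : INR (2 * n) = w) by (rewrite mult_INR; reflexivity). rewrite Hw in E.
  assert (Cp := cosh_pos (w * x)). assert (Sx := sinh_pos x Hx).
  assert (R2 : 0 < w ^ 2 * sinh x ^ 2 + cosh (w * x) ^ 2).
  { generalize (pow2_ge_0 (w * sinh x)) (pow_lt (cosh (w * x)) 2 Cp). lra. }
  exists (sqrt (w ^ 2 * sinh x ^ 2 + cosh (w * x) ^ 2)). split; [now apply sqrt_lt_R0|].
  intros t th Ht. rewrite pow2_sqrt by lra.
  assert (Hsq : sinh t ^ 2 = sinh x ^ 2 /\ cosh (w * t) = cosh (w * x)).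
  { destruct Ht as [-> | ->]; [|easy]. rewrite sinh_opp. replace (w * - x) with (- (w * x)) by ring.
    rewrite cosh_opp. split; [ring | easy]. }
  split.
  - destruct Hsq as [<- <-]. unfold pt, dot, moebius. fold w.
    transitivity (w ^ 2 * sinh t ^ 2 * (sin th * sin th + cos th * cos th) + cosh (w * t) ^ 2 *
       (sin (w * th) * sin (w * th) + cos (w * th) * cos (w * th))); [ring|].
    assert (E1 := sin2_cos2 th). assert (E2 := sin2_cos2 (w * th)). unfold Rsqr in E1, E2.
    rewrite E1, E2; ring.
  - assert (Hmu : exists mu, forall i, X_t (moebius n) t th i = mu * moebius n i t th).
    { assert (Ht' : cosh t * cosh (w * t) = w * sinh (w * t) * sinh t /\ sinh t <> 0).
      { unfold tanh, coth in E. 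
        assert (K : cosh x * cosh (w * x) = w * sinh (w * x) * sinh x).
        { apply (Rmult_eq_reg_r (/ (sinh x * cosh (w * x)))).
          - transitivity (cosh x / sinh x); [field; lra|]. rewrite <- E. field; lra.
          - apply Rinv_neq_0_compat; nra. }
        destruct Ht as [-> | ->]; [|split; [easy | lra]].
        replace (w * - x) with (- (w * x)) by ring. rewrite !cosh_opp, !sinh_opp, K. split; [ring | lra]. }
      destruct Ht' as [K Hs]. exists (cosh t / sinh t). intros i.
      rewrite <- (translate_0 (moebius n)) at 1. rewrite moebius_X_t, Rplus_0_r. fold w.
      unfold moebius; fold w. 
      assert (K' : cosh t / sinh t * cosh (w * t) = w * sinh (w * t)).
      { unfold Rdiv. rewrite Rmult_comm, <- Rmult_assoc, (Rmult_comm (cosh (w * t))), K. field; easy. }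
      destruct i.
      - field; easy.
      - field; easy.
      - rewrite <- Rmult_assoc, K'. ring.
      - rewrite <- Rmult_assoc, K'. ring. }
    destruct Hmu as [mu Hmu]. intros p q v Hv u Hu.
    assert (Hq := proj1 (moebius_tangent_coefficients n t th p q Hn) Hv).
    replace (dot v u) with (p * mu * dot u (pt (moebius n) t th)).
    + rewrite Hu; ring.
    + unfold v, dot, pt. rewrite Hq, !Hmu. ring.
Qed.

Theorem theorem3p3 (n : nat) (hn : (1 <= n)%nat) :
  immersion (moebius n) (- (T_k1 (2 * n) / 2)) (T_k1 (2 * n) / 2)
  /\ factors_through_moebius (moebius n)
  /\ meets_ball_orthogonally (moebius n) (- (T_k1 (2 * n) / 2)) (T_k1 (2 * n) / 2)
  /\ maximizes_normalized_steklov (4 * n)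
       (induced_metric (translate (moebius n) (- (T_k1 (2 * n) / 2)))) (T_k1 (2 * n)).
Proof.
  destruct (T_k1_spec (2 * n) ltac:(lia)) as [HT E].
  set (T := T_k1 (2 * n)) in *. set (x := T / 2) in *.
  assert (Hx : 0 < x) by (unfold x; lra).
  split; [now apply moebius_immersion|]. split; [apply moebius_factors|].
  split; [now apply moebius_meets_ball|]. split; [exact HT|].
  set (g := induced_metric (translate (moebius n) (- x))).
  set (f := fun t => sqrt (moebius_factor n (t + - x))).
  assert (Hf : forall t, 0 <= t <= T -> 0 < f t).
  { intros t _. now apply sqrt_lt_R0, moebius_factor_pos. }
  assert (Hg : forall t th, 0 <= t <= T ->
    gE g t th = f t ^ 2 /\ gF g t th = 0 /\ gG g t th = f t ^ 2).
  { intros t th _. unfold f. rewrite pow2_sqrt by now apply Rlt_le, moebius_factor_pos.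
    apply moebius_conformal. }
  split.
  - exists f. split; [|split; [exact Hf | exact Hg]].
    exists f; split; [|easy]. apply smooth1_sqrt; [apply smooth1_moebius_factor|].
    intros; now apply moebius_factor_pos.
  - intros g' T' HT' (f' & _ & Hf' & Hg').
    apply Rle_trans with (4 * PI * coth x).
    + now apply (normalized_steklov_upper g' T' f').
    + apply (normalized_steklov_lower g T f); auto; [unfold x; field|].
      unfold f. f_equal. replace (0 + - x) with (- x) by ring.
      replace (T + - x) with x by (unfold x; field). unfold moebius_factor.
      replace (2 * INR n * - x) with (- (2 * INR n * x)) by ring.
      rewrite cosh_opp, sinh_opp. ring.
Qed.
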